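(* There is an absolute constant $c$ such that the following holds for all $n\ge1$ and $r,d\ge3$. Let $G_n$ be a random $d$-regular graph on $n$ vertices from the uniform model, and let $C_k$, $k\ge3$, be the number of cycles of length $k$ in $G_n$. Let $(Z_k,\ k\ge3)$ be independent Poisson random variables with $\mathbf E Z_k=(d-1)^k/2k$. Then $$d_{TV}\bigl((C_3,\dots,C_r),(Z_3,\dots,Z_r)\bigr)\le\frac{c\sqrt r\,(d-1)^{3r/2-1}}{n}.$$
   Context: $d_{TV}(X,Y)$ is the total variation distance between the laws of $X$ and $Y$. The uniform model is the uniform distribution on the set of all simple (no loops or multiple edges) $d$-regular graphs on the labeled vertex set $\{1,\dots,n\}$; it is considered only for $n,d$ for which such graphs exist (in particular $nd$ is even). Cycles are simple cycles, counted as subgraphs (ignoring starting point and direction). *)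

(* Defs.v *)
From HB Require Import structures.
From mathcomp Require Import all_boot all_order all_algebra finmap.
From mathcomp Require Import all_classical all_reals all_analysis.

Set Implicit Arguments.
Unset Strict Implicit.
Unset Printing Implicit Defensive.

Import Order.TTheory GRing.Theory Num.Theory.
Local Open Scope classical_set_scope.
Local Open Scope ring_scope.

(* Simple graphs on the labelled vertex set 'I_n: an edge is a 2-element set of
   vertices, which excludes loops and multiple edges. *)
Record sgraph (n : nat) := SGraph {
  edges :> {set {set 'I_n}};
  edges_simple : [forall e in edges, #|e| == 2%N]
}.

HB.instance Definition _ (n : nat) := [isSub for @edges n].
HB.instance Definition _ (n : nat) := [Finite of sgraph n by <:].

Lemma edgeless_simple (n : nat) :
  [forall e in (finset.set0 : {set {set 'I_n}}), #|e| == 2%N].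
Proof. by apply/forall_inP => e; rewrite finset.in_set0. Qed.

HB.instance Definition _ (n : nat) :=
  isPointed.Build (sgraph n) (SGraph (edgeless_simple n)).

HB.instance Definition _ (n : nat) := @isMeasurable.Build default_measure_display
  (sgraph n) discrete_measurable discrete_measurable0
  discrete_measurableC discrete_measurableU.

Definition degree (n : nat) (g : sgraph n) (v : 'I_n) : nat :=
  #|[set e in edges g | v \in e]%SET|.

Definition regular_graphs (n d : nat) : {set sgraph n} :=
  [set g | [forall v, degree g v == d]]%SET.

(* The edge set of the closed walk s_0, s_1, ..., s_(k-1), s_0. *)
Definition cycle_edges (n : nat) (s : seq 'I_n) : {set {set 'I_n}} :=
  [set [set x; next s x] | x in s]%SET.

Definition is_cycle (n k : nat) (F : {set {set 'I_n}}) : bool :=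
  [exists t : k.-tuple 'I_n, uniq t && (F == cycle_edges t)].

(* For k >= 3 a cycle subgraph is determined by its edge set, so each cycle is
   counted once, irrespective of starting point and direction. *)
Definition cycle_count (n k : nat) (g : sgraph n) : nat :=
  #|[set F : {set {set 'I_n}} | (F \subset edges g) && is_cycle k F]%SET|.

Definition uniform_regular_graph (n d : nat) (dT : measure_display)
    (T : measurableType dT) (R : realType) (P : probability T R)
    (G : {RV P >-> sgraph n}) : Prop :=
  forall g : sgraph n, P (G @^-1` [set g]) =
    (if g \in regular_graphs n d then #|regular_graphs n d|%:R^-1 else 0)%:E.

Definition poisson_distributed (dT : measure_display) (T : measurableType dT)
    (R : realType) (P : probability T R) (X : {RV P >-> nat}) (rate : R) : Prop :=
  forall j : nat, P (X @^-1` [set j]) = (poisson_pmf rate j)%:E.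

Definition mutually_independent (dT : measure_display) (T : measurableType dT)
    (dU : measure_display) (U : measurableType dU) (R : realType)
    (P : probability T R) (I : choiceType) (D : set I)
    (X : I -> {RV P >-> U}) : Prop :=
  forall (J : {fset I}) (A : I -> set U),
    [set` J] `<=` D -> (forall i, measurable (A i)) ->
    P (\bigcap_(i in [set` J]) (X i @^-1` A i)) =
    (\prod_(i <- J) P (X i @^-1` A i))%E.

Definition dTV (dT : measure_display) (T : measurableType dT) (R : realType)
    (mu nu : set T -> \bar R) : \bar R :=
  ereal_sup [set `|mu A - nu A|%E | A in measurable].

(* Main.v *)
Require Import Defs.
From HB Require Import structures.
From mathcomp Require Import all_boot all_order all_algebra finmap.
From mathcomp Require Import all_classical all_reals all_analysis.
From mathcomp Require Import zify ring lra.

Set Implicit Arguments.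
Unset Strict Implicit.
Unset Printing Implicit Defensive.

Import Order.TTheory GRing.Theory Num.Theory.
Import numFieldNormedType.Exports.

(** Write [q] for [d - 1] and call a cycle short if its length is at most [r].

    Graphs with a [k]-cycle are matched with graphs with a path of [k + 1] edges:
    if [v_0, v_1, ..., v_k, v_(k+1)] is a path, the switch that replaces its two
    end edges by [v_0 v_(k+1)] and [v_1 v_k] closes the middle part of the path to
    a [k]-cycle, and this can be undone.  A [d]-regular graph has [n d q^k] walks
    of [k + 1] steps that never turn back, almost all of them paths, and it has
    [2 k C_k] rooted oriented [k]-cycles and [n d] oriented edges with which these
    can be opened.  If every switch were possible and changed no other short cycle
    count, then [C_k] would satisfy the detailed balance condition of the birth
    and death chain with rates [n d q^k] and [2 k n d C_k], whose stationary law is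
    the Poisson law with mean [q^k / 2k], independently of the other counts.

    Stein's method makes this quantitative.  The counts are replaced by Poisson
    variables one after another.  For each of them, the good switches cancel from
    the Stein equation ([switch_exchange]), and the error is the Poisson mean times
    the proportion of bad switches times the bound on the solution of the Stein
    equation, which is of the order of the inverse standard deviation
    ([stein_bound]).  Since the good
    switches have the same total number on either side, it suffices to bound that
    number from below by counting paths, and to bound the expectation of [C_k]
    from above.

    A switch at a path can be bad only if the graph has a detour, that is, a short
    connection of two vertices of the path that runs off the path
    ([no_detour_switchable], [no_detour_cycle_count]).  Together with the stretch
    of the path that it bypasses, the detour is a cycle.  Opening cycles by
    switches shows that on average there are at most [2 q^L] rooted cycles of each
    length [L] up to [2 r] ([count_simple_cycle_le]), and hence that detours of a
    given shape are rarer than free walks by a factor of order [1 / n]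
    ([count_excursion]).  Altogether the proportion of bad switches is of the
    order of [k q^(r-1) / n] ([good_total_lower]).

    The coordinate [k] thus contributes an error of the order of
    [sqrt k * q^(k/2 + r - 1) / n].  These errors grow geometrically with [k], so
    the last one dominates their sum, which gives the bound of the theorem.  All
    this needs [8 r + 4 d <= n]; for smaller [n] the bound is at least 1. *)

(** * Sums over sequences of a given length *)

Section SumSeq.
Variable T : finType.
Implicit Types (F : seq T -> nat) (s u : seq T).

(** The recursion lets sequences be concatenated, reversed and cut without the
    casts that sums over tuples would need. *)
Fixpoint sumseq m F : nat :=
  if m is m'.+1 then \sum_x sumseq m' (fun s => F (x :: s)) else F [::].

Lemma leq_sumseq m F1 F2 : (forall s, size s = m -> F1 s <= F2 s) ->
  sumseq m F1 <= sumseq m F2.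
Proof.
elim: m F1 F2 => [|m IHm] F1 F2 leF /=; first exact: leF.
by apply: leq_sum => x _; apply: IHm => s sz_s; apply: leF; rewrite /= sz_s.
Qed.

Lemma eq_sumseq m F1 F2 : (forall s, size s = m -> F1 s = F2 s) ->
  sumseq m F1 = sumseq m F2.
Proof.
by move=> eqF; apply/eqP; rewrite eqn_leq !leq_sumseq // => s /eqF ->.
Qed.

Lemma sumseq_cat p q F :
  sumseq (p + q) F = sumseq p (fun s => sumseq q (fun u => F (s ++ u))).
Proof. by elim: p F => [|p IHp] F //=; apply: eq_bigr => x _; rewrite IHp. Qed.

Lemma sumseq_big m (I : Type) (r : seq I) (P : pred I) (F : I -> seq T -> nat) :
  sumseq m (fun s => \sum_(i <- r | P i) F i s) =
  \sum_(i <- r | P i) sumseq m (F i).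
Proof.
elim: m F => [|m IHm] F //=.
by rewrite exchange_big /=; apply: eq_bigr => x _; rewrite IHm.
Qed.

Lemma sumseqMl m c F : sumseq m (fun s => c * F s) = c * sumseq m F.
Proof.
by elim: m F => [|m IHm] F //=; rewrite big_distrr /=; apply: eq_bigr.
Qed.

Lemma sumseqMr m c F : sumseq m (fun s => F s * c) = sumseq m F * c.
Proof.
by elim: m F => [|m IHm] F //=; rewrite big_distrl /=; apply: eq_bigr.
Qed.

Lemma sumseqD m F1 F2 :
  sumseq m (fun s => F1 s + F2 s) = sumseq m F1 + sumseq m F2.
Proof.
elim: m F1 F2 => [|m IHm] F1 F2 //=.
by rewrite -big_split /=; apply: eq_bigr.
Qed.

Lemma exchange_sumseq p q (F : seq T -> seq T -> nat) :
  sumseq p (fun s => sumseq q (F s)) = sumseq q (fun u => sumseq p (F^~ u)).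
Proof.
elim: p F => [|p IHp] F //=.
by rewrite sumseq_big; apply: eq_bigr => x _; rewrite IHp.
Qed.

Lemma sumseq_rcons m F :
  sumseq m.+1 F = sumseq m (fun s => \sum_x F (rcons s x)).
Proof.
rewrite -addn1 sumseq_cat; apply: eq_sumseq => s _.
by apply: eq_bigr => x _; rewrite cats1.
Qed.

Lemma sumseq_rev m F : sumseq m (fun s => F (rev s)) = sumseq m F.
Proof.
elim: m F => [|m IHm] F //.
rewrite [RHS]sumseq_rcons sumseq_big /=; apply: eq_bigr => x _.
rewrite -[RHS]IHm; apply: eq_sumseq => s _ /=; by rewrite rev_cons.
Qed.

Lemma sumseq_tuple m F : sumseq m F = \sum_(t : m.-tuple T) F t.
Proof.
elim: m F => [|m IHm] F /=.
  rewrite (big_pred1 [tuple]) // => t; apply/esym/eqP.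
  exact: tuple0.
rewrite (eq_bigr _ (fun x _ => IHm _)) pair_big /=.
rewrite (reindex (fun t : m.+1.-tuple T => (thead t, [tuple of behead t]))) /=.
  by apply: eq_bigr => t _; case/tupleP: t => x t; rewrite theadE.
exists (fun p : T * m.-tuple T => [tuple of p.1 :: p.2]) => [t _|[x t] _] /=.
  by rewrite [RHS]tuple_eta; apply: val_inj.
by congr pair; apply: val_inj.
Qed.

Lemma sumseq_ge m F s : size s = m ->
  F s <= sumseq m F.
Proof.
elim: m s F => [|m IHm] [|x s] F //= [sz_s].
by rewrite (bigD1 x) //= (leq_trans (IHm s (fun s' => F (x :: s')) sz_s)) ?leq_addr.
Qed.

Lemma sumseq_ends m F :
  sumseq m.+2 F = \sum_x sumseq m (fun c => \sum_y F (x :: rcons c y)).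
Proof.
transitivity (\sum_x sumseq m.+1 (fun s => F (x :: s))); first by [].
by apply: eq_bigr => x _; rewrite sumseq_rcons.
Qed.

End SumSeq.

(** * Switchings *)

Section Switching.
Variable n : nat.
Implicit Types (g : sgraph n) (a b u v x y : 'I_n).

Definition adjacent g x y := [set x; y]%SET \in edges g.

Definition same_pair u v a b :=
  (u == a) && (v == b) || (u == b) && (v == a).

Lemma eq_set2 u v a b : ([set u; v] == [set a; b])%SET = same_pair u v a b.
Proof.
apply/eqP/idP => [eq_uv | ]; last first.
  by case/orP=> /andP[/eqP-> /eqP->] //; rewrite finset.setUC.
have /[!finset.inE] uP : u \in [set a; b]%SET by rewrite -eq_uv !finset.inE eqxx.
have /[!finset.inE] vP : v \in [set a; b]%SET.
  by rewrite -eq_uv !finset.inE eqxx orbT.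
have /[!finset.inE] aP : a \in [set u; v]%SET by rewrite eq_uv !finset.inE eqxx.
have /[!finset.inE] bP : b \in [set u; v]%SET.
  by rewrite eq_uv !finset.inE eqxx orbT.
case/orP: uP => /eqP ?; case/orP: vP => /eqP ?; case/orP: aP => /eqP ?;
  case/orP: bP => /eqP ?; subst; by rewrite /same_pair ?eqxx ?orbT.
Qed.

Lemma adjacentC g x y : adjacent g x y = adjacent g y x.
Proof. by rewrite /adjacent finset.setUC. Qed.

Lemma edge_card2 g (e : {set 'I_n}) : e \in edges g -> #|e| = 2.
Proof. by move=> eg; apply/eqP/(forall_inP (edges_simple g)). Qed.

Lemma adjacent_irr g x : adjacent g x x = false.
Proof. by apply/negP => /edge_card2; rewrite finset.setUid cards1. Qed.

Lemma adjacent_neq g x y : adjacent g x y -> x != y.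
Proof. by apply: contraTneq => ->; rewrite adjacent_irr. Qed.

Lemma sgraph_ext g1 g2 : (forall x y, adjacent g1 x y = adjacent g2 x y) ->
  g1 = g2.
Proof.
move=> eqg; apply: val_inj; apply/setP => e /=.
have step h1 h2 : (forall x y, adjacent h1 x y = adjacent h2 x y) ->
    e \in edges h1 -> e \in edges h2.
  move=> eqh eh; have /eqP/cards2P[x [y [_ def_e]]] := edge_card2 eh.
  by move: eh; rewrite def_e; have := eqh x y; rewrite /adjacent => ->.
by apply/idP/idP; apply: step => // x y; rewrite eqg.
Qed.

Lemma degreeE g v : degree g v = \sum_x adjacent g v x.
Proof.
rewrite /degree.
have -> : [set e in edges g | v \in e]%SET =
    [set [set v; x]%SET | x in [set x | adjacent g v x]%SET]%SET.
  apply/setP => e; rewrite finset.inE; apply/andP/imsetP => [[eg ve]|[x]].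
    have /eqP/cards2P[x [y [_ def_e]]] := edge_card2 eg.
    move: ve; rewrite def_e !finset.inE => /orP[] /eqP def_v.
      by exists y; rewrite ?finset.inE /adjacent def_v // -def_e.
    by exists x; rewrite ?finset.inE /adjacent def_v finset.setUC // -def_e.
  by rewrite finset.inE => vx ->; rewrite !finset.inE eqxx.
rewrite card_in_imset; first by rewrite -sum1dep_card big_mkcond; apply: eq_bigr => x _; case: adjacent.
move=> x y _ _ /eqP; rewrite eq_set2 /same_pair eqxx /= => /orP[/eqP //|].
by case/andP=> /eqP -> /eqP ->.
Qed.

Definition switch g a b x y : sgraph n :=
  insubd g ((edges g :\ [set a; b] :\ [set x; y])
            :|: [set [set a; x]; [set b; y]])%SET.

Definition switchable g a b x y :=
  [&& uniq [:: a; b; x; y], adjacent g a b, adjacent g x y,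
      ~~ adjacent g a x & ~~ adjacent g b y].

Lemma adjacent_switch g a b x y u v : switchable g a b x y ->
  adjacent (switch g a b x y) u v =
  [|| [&& adjacent g u v, ~~ same_pair u v a b & ~~ same_pair u v x y],
      same_pair u v a x | same_pair u v b y].
Proof.
case/and5P=> uniq4 _ _ _ _; rewrite {1}/adjacent.
rewrite (_ : edges _ = (edges g :\ [set a; b] :\ [set x; y])
            :|: [set [set a; x]; [set b; y]])%SET; last first.
  rewrite [LHS](@insubdK _ _ (sgraph n)) //; apply/forall_inP => e.
  rewrite !finset.inE => /orP[/and3P[_ _ /edge_card2 -> //]|].
  move: uniq4; rewrite /= !inE !negb_or => /and4P[/and3P[_ ax _] /andP[_ b_y] _ _].
  by case/orP=> /eqP ->; rewrite cards2 ?ax ?b_y.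
rewrite !finset.inE !eq_set2 /adjacent.
by case: (_ \in _); case: same_pair; case: same_pair; case: same_pair; case: same_pair.
Qed.

Lemma adjacent_same_pair g a b u v : same_pair u v a b ->
  adjacent g u v = adjacent g a b.
Proof. by case/orP=> /andP[/eqP-> /eqP->] //; rewrite adjacentC. Qed.

(** With these facts, identities between [g] and the switched graph become
    tautologies in the truth values of the four [same_pair]. *)
Lemma switch_pairs g a b x y u v : switchable g a b x y ->
  [/\ same_pair u v a b -> adjacent g u v, same_pair u v x y -> adjacent g u v,
      same_pair u v a x -> ~~ adjacent g u v,
      same_pair u v b y -> ~~ adjacent g u v &
      ~~ (same_pair u v a b && same_pair u v x y) /\
      ~~ (same_pair u v a x && same_pair u v b y)].
Proof.
case/and5P=> uniq4 ab xy ax b_y.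
split; try by move/(adjacent_same_pair g) => ->.
move: uniq4; rewrite /= !inE !negb_or.
case/and4P=> /and3P[neab neax neay] /andP[nebx neby] nexy _.
split; apply/negP=> /andP[/orP[] /andP[/eqP-> /eqP->]] /orP[] /andP[];
  by rewrite ?(negPf neab) ?(negPf neax) ?(negPf neay) ?(negPf nebx)
             ?(negPf neby) ?(negPf nexy).
Qed.

Lemma switchable_switch g a b x y : switchable g a b x y ->
  switchable (switch g a b x y) a x b y.
Proof.
move=> sw; have:= sw; case/and5P=> uniq4 ab xy ax b_y.
rewrite /switchable !(adjacent_switch _ _ sw) /same_pair !eqxx /= ?orbT ?andbT /=.
move: uniq4; rewrite /= !inE !negb_or.
case/and4P=> /and3P[neab neax neay] /andP[nebx neby] nexy _.
rewrite (eq_sym x b) (eq_sym x a) (eq_sym b a) (eq_sym y b) (eq_sym y a) (eq_sym y x).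
by rewrite ?(negPf neab) ?(negPf neax) ?(negPf neay) ?(negPf nebx)
           ?(negPf neby) ?(negPf nexy) /= ?andbF ?orbF.
Qed.

Lemma switchK g a b x y : switchable g a b x y ->
  switch (switch g a b x y) a x b y = g.
Proof.
move=> sw; apply: sgraph_ext => u v.
rewrite (adjacent_switch _ _ (switchable_switch sw)) (adjacent_switch _ _ sw).
have [/implyP + /implyP + /implyP + /implyP + [+ +]] := switch_pairs u v sw.
by case: (adjacent g u v); case: (same_pair u v a b); case: (same_pair u v x y);
  case: (same_pair u v a x); case: (same_pair u v b y).
Qed.

Lemma degree_switch g a b x y v : switchable g a b x y ->
  degree (switch g a b x y) v = degree g v.
Proof.
move=> sw; rewrite !degreeE.
(* Every vertex loses as many edges as it gains: the two sides agree term by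
   term once the removed and the added pairs are both accounted for. *)
have sum_pair c e : c != e ->
    \sum_z (same_pair v z c e : nat) = (v == c) + (v == e).
  move=> nece; have nece' : (e == c) = false by rewrite eq_sym (negPf nece).
  rewrite (bigD1 c) //= (bigD1 e) ?nece' //= big1 => [|z /andP[zc ze]].
    by rewrite /same_pair !eqxx (negPf nece) nece' !andbF !andbT orbF /= addn0 addnC.
  by rewrite /same_pair (negPf zc) (negPf ze) !andbF.
move: (sw) => /and5P[]; rewrite /= !inE !negb_or.
case/and4P=> /and3P[neab neax neay] /andP[nebx neby] nexy _ _ _ _ _.
apply/eqP; rewrite -(eqn_add2r ((v == a) + (v == b) + ((v == x) + (v == y)))).
rewrite -[X in _ == _ + X]addnACA -!sum_pair // -!big_split /=.
apply/eqP; apply: eq_bigr => z _; rewrite (adjacent_switch _ _ sw).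
have [/implyP + /implyP + /implyP + /implyP + [+ +]] := switch_pairs v z sw.
by case: (adjacent g v z); case: (same_pair v z a b); case: (same_pair v z x y);
  case: (same_pair v z a x); case: (same_pair v z b y).
Qed.

Lemma switch_regular d g a b x y : switchable g a b x y ->
  (switch g a b x y \in regular_graphs n d) = (g \in regular_graphs n d).
Proof.
move=> sw; rewrite !finset.inE; apply: eq_forallb => v.
by rewrite degree_switch.
Qed.

(** A fixed switch and its inverse exchange two sets of regular graphs, so a
    sum over graphs paired with the switched graph may be read from either
    side. *)
Lemma sum_switch (V : nmodType) d a b x y (F : sgraph n -> sgraph n -> V) :
  (\sum_(h in regular_graphs n d | switchable h a b x y)
     F h (switch h a b x y) =
   \sum_(g in regular_graphs n d | switchable g a x b y)
     F (switch g a x b y) g)%R.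
Proof.
rewrite (reindex_onto (fun g => switch g a x b y) (fun h => switch h a b x y)) /=.
  apply: eq_big => [g | g /andP[/andP[_ _] /eqP -> //]].
  apply/idP/idP => [/andP[/andP[hR sw] /eqP eqg]|/andP[gR sw]].
    rewrite -eqg switchable_switch // andbT; move: sw; move: hR.
    set h := switch g a x b y => hR sw.
    by rewrite switch_regular.
  by rewrite switch_regular // gR switchable_switch // switchK // eqxx.
by move=> h /andP[_ sw]; rewrite switchK.
Qed.

End Switching.

(** * Simple paths and cycles in regular graphs *)

Section Paths.
Variable n : nat.
Implicit Types (g h : sgraph n) (s t u c : seq 'I_n).

Definition simple_path g s := uniq s && sorted (adjacent g) s.
Definition simple_cycle g c := uniq c && cycle (adjacent g) c.

Lemma simple_path_rev g s : simple_path g (rev s) = simple_path g s.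
Proof.
rewrite /simple_path rev_uniq rev_sorted; congr (_ && _).
by apply: eq_sorted => x y; rewrite adjacentC.
Qed.

Lemma simple_path_catl g s t : simple_path g (s ++ t) -> simple_path g s.
Proof.
by case/andP; rewrite cat_uniq => /andP[us _] /cat_sorted2[ps _]; apply/andP.
Qed.

Lemma simple_path_catr g s t : simple_path g (s ++ t) -> simple_path g t.
Proof.
by case/andP; rewrite cat_uniq => /and3P[_ _ ut] /cat_sorted2[_ pt]; apply/andP.
Qed.

Variable d : nat.

Lemma regular_sum g v : g \in regular_graphs n d -> \sum_x adjacent g v x = d.
Proof. by rewrite -degreeE finset.inE => /forallP /(_ v) /eqP. Qed.

Section Regular.
Variable g : sgraph n.
Hypothesis g_reg : g \in regular_graphs n d.

(** The next vertex has to be one of the [d.-1] neighbours of [a] other than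
    [b]. *)
Lemma simple_path_cons a b s :
  \sum_x simple_path g (x :: a :: b :: s) <= d.-1 * simple_path g (a :: b :: s).
Proof.
case: (boolP (simple_path g (a :: b :: s))) => [abs|Nabs]; last first.
  rewrite muln0 leqn0 sum_nat_eq0; apply/forall_inP => x _.
  by rewrite eqb0; apply: contra Nabs; apply: (@simple_path_catr g [:: x]).
have ab : adjacent g a b by case/and3P: abs.
rewrite muln1 -(regular_sum a g_reg) [in leqRHS](bigD1 b) //= ab add1n /=.
rewrite (bigD1 b) //= (_ : simple_path g _ = false) ?add0n; last first.
  by rewrite /simple_path /= !inE eqxx !orbT.
apply: leq_sum => x _; rewrite adjacentC.
by case: (boolP (simple_path g _)) => // /andP[_ /andP[->]].
Qed.

Lemma simple_path_prepend p s : 2 <= size s ->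
  sumseq p (fun u => simple_path g (u ++ s)) <= d.-1 ^ p * simple_path g s.
Proof.
move=> s2; elim: p => [|p IHp] /=; first by rewrite mul1n.
rewrite -(@sumseq_big _ p _ _ predT (fun x u => simple_path g (x :: u ++ s))).
rewrite expnS -mulnA; apply: leq_trans (leq_mul (leqnn _) IHp).
rewrite -sumseqMl; apply: leq_sumseq => u _.
have: 2 <= size (u ++ s) by rewrite size_cat (leq_trans s2) ?leq_addl.
by case: (u ++ s) => [|a [|b t]] // _; apply: simple_path_cons.
Qed.

Lemma simple_path_append q s : 2 <= size s ->
  sumseq q (fun t => simple_path g (s ++ t)) <= d.-1 ^ q * simple_path g s.
Proof.
move=> s2; rewrite -sumseq_rev -(simple_path_rev g s).
apply: leq_trans (simple_path_prepend q _); last by rewrite size_rev.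
by apply: leq_sumseq => t _; rewrite -simple_path_rev rev_cat revK.
Qed.

Lemma simple_path_extend p q s : 2 <= size s ->
  sumseq p (fun u => sumseq q (fun t => simple_path g (u ++ s ++ t))) <=
  d.-1 ^ (p + q) * simple_path g s.
Proof.
move=> s2; rewrite addnC expnD -mulnA.
apply: leq_trans (leq_mul (leqnn _) (simple_path_prepend p s2)).
rewrite -sumseqMl; apply: leq_sumseq => u _.
under eq_sumseq do rewrite catA.
by apply: simple_path_append; rewrite size_cat (leq_trans s2) ?leq_addl.
Qed.

Lemma sum_adjacent : \sum_x \sum_y adjacent g x y = n * d.
Proof.
rewrite (eq_bigr (fun=> d)) => [|x _]; last exact: regular_sum.
by rewrite sum_nat_const card_ord.
Qed.

Lemma count_simple_path1 : sumseq 2 (fun s => simple_path g s) = n * d.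
Proof.
rewrite /= -sum_adjacent; apply: eq_bigr => x _; apply: eq_bigr => y _.
rewrite /simple_path /= inE andbT !andbT.
by case: (boolP (adjacent g x y)) => [/adjacent_neq ->|_]; rewrite ?andbF.
Qed.

Lemma count_simple_path m :
  sumseq m.+2 (fun s => simple_path g s) <= n * d * d.-1 ^ m.
Proof.
rewrite -[m.+2]addn2 sumseq_cat exchange_sumseq -count_simple_path1 mulnC.
rewrite -sumseqMl; apply: leq_sumseq => s s2.
by apply: simple_path_prepend; rewrite s2.
Qed.

(** The oriented edges [(x, y)] with which the closing edge of the cycle [c]
    can be switched so that [c] opens up into a longer simple path. *)
Definition opens c x y :=
  [&& adjacent g x y, x \notin c, y \notin c,
      ~~ adjacent g x (head x c) & ~~ adjacent g y (last y c)].

(** Each of the conditions of [opens] excludes few oriented edges: an end on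
    [c] at most [size c * d], an end adjacent to a given vertex at most
    [d * d]. *)
Lemma count_opens c : 0 < size c ->
  n * d <= \sum_x \sum_y opens c x y + (2 * size c * d + 2 * d * d).
Proof.
case: c => // a c _; set b := last a c.
have le1 : \sum_x \sum_y adjacent g x y * (x \in a :: c) <= size (a :: c) * d.
  rewrite (eq_bigr (fun x => d * (x \in a :: c))) => [|x _]; last first.
    by rewrite -big_distrl /= regular_sum.
  rewrite -big_distrr /= mulnC leq_mul2r; apply/orP; right.
  rewrite -[X in X <= _]/(\sum_x (x \in a :: c : nat)) -big_mkcond /=.
  by rewrite sum1_card card_size.
have le1' : \sum_x \sum_y adjacent g x y * (y \in a :: c) <= size (a :: c) * d.
  apply: leq_trans le1; rewrite exchange_big /=.
  by apply: leq_sum => x _; apply: leq_sum => y _; rewrite adjacentC.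
have le2 z : \sum_x \sum_y adjacent g x y * adjacent g x z <= d * d.
  rewrite (eq_bigr (fun x => d * adjacent g z x)) => [|x _].
    by rewrite -big_distrr /= regular_sum.
  by rewrite -big_distrl /= regular_sum // adjacentC.
have le2' z : \sum_x \sum_y adjacent g x y * adjacent g y z <= d * d.
  apply: leq_trans (le2 z); rewrite exchange_big /=.
  by apply: leq_sum => x _; apply: leq_sum => y _; rewrite adjacentC.
have -> : 2 * size (a :: c) * d + 2 * d * d =
  size (a :: c) * d + size (a :: c) * d + (d * d + d * d) by lia.
apply: leq_trans (leq_add (leqnn _)
  (leq_add (leq_add le1 le1') (leq_add (le2 a) (le2' b)))).
rewrite -sum_adjacent -!big_split /=; apply: leq_sum => x _.
rewrite -!big_split /=; apply: leq_sum => y _.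
rewrite /opens /= -/b.
by case: (adjacent g x y) (x \in _) (y \in _) (adjacent g x a) (adjacent g y b)
  => [] [] [] [] [].
Qed.

(** The switch removes no edge of the path [c], as [x] and [y] are off [c] and
    its closing edge joins two vertices that are not consecutive. *)
Lemma opens_path c x y : 3 <= size c -> simple_cycle g c -> opens c x y ->
  switchable g x y (head x c) (last y c) /\
  simple_path (switch g x y (head x c) (last y c)) (x :: rcons c y).
Proof.
case: c => [|a [|a' [|a'' c]]] // _ /andP[uc cc] /and5P[xy xc yc xa yb].
move: xa yb; rewrite [head _ _]/= [last _ _]/=; set b := last a'' c => xa yb.
have bc : b \in a'' :: c by apply: mem_last.
have ab : a != b.
  by apply: contraTneq uc => ->; rewrite /= inE bc orbT.
have a'b : a' != b.
  by apply: contraTneq uc => ->; rewrite /= bc !andbF.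
have xb : x != b by apply: contraNneq xc => ->; rewrite !in_cons in bc *; rewrite bc !orbT.
have yb' : y != b by apply: contraNneq yc => ->; rewrite !in_cons in bc *; rewrite bc !orbT.
have xa' : x != a by apply: contraNneq xc => ->; rewrite mem_head.
have ya' : y != a by apply: contraNneq yc => ->; rewrite mem_head.
move: (cc); rewrite (cycle_path a) [last _ _]/= -/b => /= /and4P[ba aa1 a12 pc].
have sw : switchable g x y a b.
  rewrite /switchable /= !inE !negb_or (adjacent_neq xy) xa' xb ya' yb' ab xy /=.
  by rewrite adjacentC ba xa yb.
split=> //.
have uv : uniq (x :: rcons [:: a, a', a'' & c] y).
  rewrite cons_uniq rcons_uniq yc uc mem_rcons inE negb_or (adjacent_neq xy).
  by rewrite xc.
have ne_notin (z w : 'I_n) (l : seq 'I_n) : z \in l -> w \notin l -> (z == w) = false.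
  by move=> zl; apply: contraNF => /eqP <-.
have a'c : a' \in [:: a, a', a'' & c] by rewrite !inE eqxx orbT.
have a'a : (a' == a) = false.
  by apply/negbTE; move: uc; rewrite /= !inE eq_sym => /andP[] /norP[].
have P : path (adjacent (switch g x y a b)) a' (a'' :: c).
  have: path (adjacent g) a' (a'' :: c) by rewrite /= a12 pc.
  apply: (@sub_in_path _ (mem [:: a', a'' & c]) (adjacent g)); last exact/allP.
  move=> z w zc wc /= zw; rewrite (adjacent_switch _ _ sw) zw /=.
  have zc' : z \in [:: a, a', a'' & c] by rewrite inE zc orbT.
  have wc' : w \in [:: a, a', a'' & c] by rewrite inE wc orbT.
  have ac : a \notin [:: a', a'' & c] by case/andP: uc.
  rewrite /same_pair (ne_notin _ _ _ zc' xc) (ne_notin _ _ _ zc' yc).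
  rewrite (ne_notin _ _ _ wc' xc) (ne_notin _ _ _ wc' yc) /=.
  by rewrite (ne_notin _ _ _ zc ac) (ne_notin _ _ _ wc ac) !andbF.
rewrite /simple_path uv; move: P; rewrite /= rcons_path -/b => /andP[-> ->].
rewrite !(adjacent_switch _ _ sw) aa1 /same_pair !eqxx ?orbT ?andbT /=.
rewrite (ne_notin _ _ _ a'c xc) (ne_notin _ _ _ a'c yc) !andbF /=.
by rewrite (negPf a'b) a'a !andbF.
Qed.

End Regular.

(** Opening the closing edge of a cycle of length [L] by a switch gives a path
    with [L.+2] vertices from which the switch can be undone; all but
    [2 * L * d + 2 * d * d] of the [n * d] oriented edges can serve. *)
Lemma count_simple_cycle L : 3 <= L ->
  n * d * (\sum_(g in regular_graphs n d) sumseq L (fun c => simple_cycle g c)) <=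
  #|regular_graphs n d| * (n * d * d.-1 ^ L) +
  (2 * L * d + 2 * d * d) *
    (\sum_(g in regular_graphs n d) sumseq L (fun c => simple_cycle g c)).
Proof.
move=> L3; pose R := regular_graphs n d.
apply: (@leq_trans (\sum_(g in R) sumseq L (fun c =>
   simple_cycle g c * \sum_x \sum_y opens g c x y) + (2 * L * d + 2 * d * d) *
    (\sum_(g in R) sumseq L (fun c => simple_cycle g c)))).
  rewrite !big_distrr -big_split /=; apply: leq_sum => g gR.
  rewrite -!sumseqMl -sumseqD; apply: leq_sumseq => c sz_c.
  rewrite [leqRHS]addnC mulnC [X in _ <= X + _]mulnC -mulnDr leq_mul2l; apply/orP; right.
  by rewrite addnC -sz_c; apply: count_opens; rewrite // sz_c (leq_trans _ L3).
rewrite leq_add2r.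
apply: (@leq_trans (\sum_(h in R) sumseq L.+2 (fun s => simple_path h s))); last first.
  rewrite -sum1_card big_distrl /=; apply: leq_sum => h hR; rewrite mul1n.
  exact: count_simple_path.
rewrite (eq_bigr (fun g => sumseq L (fun c =>
    \sum_x \sum_y (simple_cycle g c && opens g c x y : nat)))); last first.
  move=> g _; apply: eq_sumseq => c _; rewrite big_distrr /=; apply: eq_bigr => x _.
  by rewrite big_distrr /=; apply: eq_bigr => y _; rewrite mulnb.
rewrite -sumseq_big [leqRHS](eq_bigr (fun h => sumseq L (fun c =>
    \sum_x \sum_y (simple_path h (x :: rcons c y) : nat)))); last first.
  move=> h _; rewrite sumseq_big.
  transitivity (\sum_x sumseq L.+1 (fun s => simple_path h (x :: s))) => //.
  apply: eq_bigr => x _.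
  exact: sumseq_rcons.
rewrite -sumseq_big; apply: leq_sumseq => c sz_c.
(* With the vertices fixed, the switch is an injection on graphs. *)
rewrite exchange_big [leqRHS]exchange_big; apply: leq_sum => x _ /=.
rewrite exchange_big [leqRHS]exchange_big; apply: leq_sum => y _ /=.
set a := head x c; set b := last y c; set v := x :: rcons c y.
apply: (@leq_trans (\sum_(g in R | switchable g x y a b)
    simple_path (switch g x y a b) v)).
  rewrite big_mkcondr /=; apply: leq_sum => g gR.
  case: (boolP (simple_cycle g c && _)) => // /andP[gc op].
  by have [|-> ->] := opens_path _ gc op; rewrite ?sz_c.
rewrite (sum_switch d x y a b (fun _ h => simple_path h v : nat)) big_mkcondr /=.
by apply: leq_sum => h _; case: ifP.
Qed.

Lemma count_simple_cycle_le L : 3 <= L -> 0 < d -> 4 * (L + d) <= n ->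
  \sum_(g in regular_graphs n d) sumseq L (fun c => simple_cycle g c) <=
  2 * #|regular_graphs n d| * d.-1 ^ L.
Proof.
move=> L3 d0 nbig; have := count_simple_cycle L3.
set X := \sum_(g in _) _; set N := #|_|; set Q := d.-1 ^ L => le_X.
have n0 : 0 < n by apply: leq_trans nbig; rewrite muln_gt0 addn_gt0 d0 orbT.
rewrite -(leq_pmul2l (_ : 0 < n * d)) ?muln_gt0 ?n0 //.
have le2 : 2 * ((2 * L * d + 2 * d * d) * X) <= n * d * X.
  have -> : 2 * ((2 * L * d + 2 * d * d) * X) = 4 * (L + d) * (d * X) by lia.
  by rewrite -[n * d * X]mulnA leq_mul2r nbig orbT.
lia.
Qed.

End Paths.

(** * Detours off a path *)

Section Excursions.
Variables (n d : nat) (v0 : 'I_n).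
Implicit Types (g h : sgraph n) (s t u w : seq 'I_n).

(** A detour [u] off the path [w], from its [i]-th to its [j]-th vertex.  The
    last conjunct excludes the edge joining two consecutive vertices of [w], so
    that the detour and the stretch of [w] that it bypasses form a cycle. *)
Definition excursion g w i j u :=
  [&& uniq (w ++ u),
      path (adjacent g) (nth v0 w i) (rcons u (nth v0 w j)) &
      2 <= j - i + size u].

Lemma excursion_cycle g p a s t u j : j = size p + size s ->
  simple_path g (p ++ (a :: s) ++ t) ->
  excursion g (p ++ (a :: s) ++ t) (size p) j u ->
  simple_cycle g ((a :: s) ++ rev u).
Proof.
move=> -> pw /and3P[uw pu _]; move: pu.
rewrite nth_cat ltnn subnn [nth _ _ 0]/= nth_cat ltnNge leq_addr /= addKn.
rewrite -cat_cons nth_cat /= ltnS leqnn.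
rewrite (_ : nth v0 (a :: s) (size s) = last a s); last first.
  by rewrite (last_nth v0).
move=> pu; apply/andP; split.
  rewrite (@perm_uniq _ _ ((a :: s) ++ u)); last by rewrite -cat_cons perm_cat2l perm_rev.
  apply: subseq_uniq uw; apply: cat_subseq => //.
  exact: subseq_trans (prefix_subseq _ t) (suffix_subseq p _).
have /andP[_ pas] : simple_path g (a :: s).
  by apply: (@simple_path_catl _ _ _ t); apply: (@simple_path_catr _ _ p).
change (path (adjacent g) a (rcons (s ++ rev u) a)).
rewrite rcons_cat cat_path.
apply/andP; split=> //.
have := rev_path (adjacent g) a (rcons u (last a s)).
rewrite last_rcons belast_rcons rev_cons => ->.
by rewrite (eq_path (e' := adjacent g)) // => x y; rewrite adjacentC.
Qed.

Lemma count_excursion_cycle g m i j l : g \in regular_graphs n d ->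
  i < j < m -> 2 <= j - i + l ->
  sumseq m (fun w => simple_path g w * sumseq l (fun u => excursion g w i j u))
  <= d.-1 ^ (m - (j - i).+1) * sumseq ((j - i).+1 + l) (fun c => simple_cycle g c).
Proof.
move=> gR /andP[ij jm] _.
have -> : m - (j - i).+1 = i + (m - j.+1) by lia.
have {1}-> : m = i + ((j - i).+1 + (m - j.+1)) by lia.
rewrite sumseq_cat; under eq_sumseq do rewrite sumseq_cat.
apply: (@leq_trans (sumseq i (fun p => sumseq (j - i).+1 (fun s =>
  sumseq (m - j.+1) (fun t => simple_path g (p ++ s ++ t) *
     sumseq l (fun u => simple_cycle g (s ++ rev u))))))).
  apply: leq_sumseq => p sz_p; apply: leq_sumseq => s sz_s.
  apply: leq_sumseq => t _; rewrite -!sumseqMl; apply: leq_sumseq => u _.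
  case: (boolP (simple_path g _)) => // pw; rewrite !mul1n.
  case: (boolP (excursion _ _ _ _ _)) => // exc.
  case: s sz_s pw exc => // a s [sz_s] pw exc.
  rewrite (@excursion_cycle g p a s t u j) ?sz_p ?sz_s //.
  by rewrite subnKC // ltnW.
rewrite exchange_sumseq sumseq_cat -sumseqMl; apply: leq_sumseq => s sz_s.
under eq_sumseq do rewrite sumseqMr.
rewrite sumseqMr (sumseq_rev l (fun u => simple_cycle g (s ++ u) : nat)).
rewrite leq_mul2r; apply/orP; right.
apply: leq_trans (simple_path_extend gR _ _ _) _; first by rewrite sz_s; lia.
by case: simple_path; lia.
Qed.

(** Each detour with [l] inner vertices closes a cycle, and the cycle costs a
    factor [1 / (n * d)] against the count of free paths. *)
Lemma count_excursion m i j l :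
  i < j < m -> 2 <= j - i + l -> 0 < d -> 4 * (m + l + d) <= n ->
  \sum_(g in regular_graphs n d) sumseq m (fun w =>
     simple_path g w * sumseq l (fun u => excursion g w i j u)) <=
  2 * #|regular_graphs n d| * d.-1 ^ (m + l).
Proof.
move=> ijm jil d0 nbig.
apply: (@leq_trans (\sum_(g in regular_graphs n d)
  d.-1 ^ (m - (j - i).+1) * sumseq ((j - i).+1 + l) (fun c => simple_cycle g c))).
  by apply: leq_sum => g gR; apply: count_excursion_cycle.
rewrite -big_distrr /=.
have le_cyc := @count_simple_cycle_le n d ((j - i).+1 + l).
apply: leq_trans (leq_mul (leqnn _) (le_cyc _ d0 _)) _; [lia | lia |].
rewrite mulnCA -expnD leq_mul2l; apply/orP; right.
by rewrite (_ : _ + (_ + _) = m + l) //; lia.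
Qed.

(** Of the [d] neighbours of the first vertex of a path, those on the path
    other than the second vertex are the ends of detours without inner
    vertices. *)
Lemma simple_path_step g m : g \in regular_graphs n d ->
  d.-1 * sumseq m.+1 (fun w => simple_path g w) <=
  sumseq m.+2 (fun w => simple_path g w) +
  \sum_(2 <= j < m.+1) sumseq m.+1 (fun w =>
     simple_path g w * sumseq 0 (fun u => excursion g w 0 j u)).
Proof.
move=> gR; rewrite [X in _ <= X + _]/(sumseq m.+2 _).
rewrite [X in _ <= X + _](_ : _ =
  sumseq m.+1 (fun w => \sum_x simple_path g (x :: w))); last first.
  by rewrite sumseq_big.
rewrite -sumseq_big -sumseqD -sumseqMl; apply: leq_sumseq => -[|a s] // [sz_s].
rewrite -big_distrr /=.
case: (boolP (simple_path g (a :: s))) => [ps|_]; last by rewrite muln0.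
rewrite muln1 mul1n.
set A := \sum_(x < n) _; set B := \sum_(2 <= _ < _) _.
suff: d <= A + 1 + B by move: A B => A B; lia.
rewrite {}/A {}/B.
have [us pas] := andP ps; have pas2 : path (adjacent g) a s := pas.
rewrite -(regular_sum a gR) (bigID (mem (a :: s))) /= addnC -addnA.
apply: leq_add.
  rewrite big_mkcond /=; apply: leq_sum => x _.
  case: ifP => // xs; rewrite /simple_path cons_uniq xs us /= pas2 andbT.
  by rewrite adjacentC.
rewrite -big_uniq //= (big_nth v0) /= sz_s.
case: m sz_s => [|m] sz_s; first by rewrite big_nat1 /= adjacent_irr.
rewrite big_ltn // big_ltn // /= adjacent_irr add0n; apply: leq_add.
  by case: adjacent.
rewrite big_nat_cond [leqRHS]big_nat_cond; apply: leq_sum => j /andP[/andP[j2 jm] _].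
rewrite /excursion cats0 us /= andbT.
by rewrite subn0 addn0 j2 andbT.
Qed.

(** There are [n * d * d.-1 ^ k] walks of [k.+1] steps that never turn back,
    and all but few of them are simple paths: a failing extension closes a
    cycle. *)
Lemma count_simple_path_lower k : 0 < d -> 4 * (k + 2 + d) <= n ->
  #|regular_graphs n d| * (n * d * d.-1 ^ k) <=
  \sum_(g in regular_graphs n d) sumseq k.+2 (fun w => simple_path g w) +
  2 * k ^ 2 * #|regular_graphs n d| * d.-1 ^ k.+1.
Proof.
move=> d0; elim: k => [|k IHk] nbig.
  rewrite !muln0 addn0 -sum1_card big_distrl /=; apply: leq_sum => g gR.
  by rewrite mul1n muln1 [leqRHS](count_simple_path1 gR).
have {}IHk := IHk ltac:(by apply: leq_trans nbig; lia).
set R := regular_graphs n d in IHk *.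
have step : d.-1 * (\sum_(g in R) sumseq k.+2 (fun w => simple_path g w)) <=
    \sum_(g in R) sumseq k.+3 (fun w => simple_path g w) +
    k * (2 * #|R| * d.-1 ^ k.+2).
  rewrite big_distrr /=.
  apply: (@leq_trans (\sum_(g in R)
    (sumseq k.+3 (fun w => simple_path g w) + \sum_(2 <= j < k.+2)
       sumseq k.+2 (fun w =>
         simple_path g w * sumseq 0 (fun u => excursion g w 0 j u))))).
    by apply: leq_sum => g gR; apply: simple_path_step.
  rewrite big_split /= leq_add2l exchange_big /=.
  apply: (@leq_trans (\sum_(2 <= j < k.+2) 2 * #|R| * d.-1 ^ k.+2)).
    rewrite big_nat_cond [leqRHS]big_nat_cond; apply: leq_sum => j /andP[/andP[j2 jm] _].
    by rewrite -[in leqRHS](addn0 k.+2); apply: count_excursion; lia.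
  by rewrite sum_nat_const_nat subSS subn1.
have IH := leq_mul (leqnn d.-1) IHk; move: step IH.
set E := \sum_(g in R) _; set E' := \sum_(g in R) _; set N := #|R|.
rewrite (expnS _ k.+1); set Q := d.-1 ^ k.+1; set q := d.-1 => step IH.
have -> : N * (n * d * Q) = q * (N * (n * d * q ^ k)).
  by rewrite /Q expnS -/q; lia.
apply: leq_trans IH _; rewrite mulnDr.
have -> : q * (2 * k ^ 2 * N * Q) = 2 * k ^ 2 * (N * (q * Q)) by lia.
have -> : 2 * k.+1 ^ 2 * N * (q * Q) = 2 * k.+1 ^ 2 * (N * (q * Q)) by lia.
have {}step : q * E <= E' + 2 * k * (N * (q * Q)) by lia.
apply: leq_trans (leq_add step (leqnn _)) _.
rewrite -addnA leq_add2l -mulnDl leq_mul2r; apply/orP; right.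
by rewrite -!mulnn; lia.
Qed.

End Excursions.

(** * Cycles as edge sets *)

Section CycleEdges.
Variable n : nat.
Implicit Types (g h : sgraph n) (s t u c : seq 'I_n) (x y z : 'I_n).

Lemma mem_cycle_edges t x y : uniq t ->
  ([set x; y]%SET \in cycle_edges t) =
  (x \in t) && ((y == next t x) || (y == prev t x)).
Proof.
move=> ut; apply/imsetP/andP => [[z zt /eqP]|[xt /orP[/eqP->|/eqP->]]].
- rewrite eq_set2 => /orP[] /andP[/eqP-> /eqP->]; first by rewrite zt eqxx.
  by rewrite mem_next zt (prev_next ut) eqxx orbT.
- by exists x.
- by exists (prev t x); rewrite ?mem_prev // next_prev // finset.setUC.
Qed.

Lemma cycle_edges_sub g t : uniq t ->
  (cycle_edges t \subset edges g) = cycle (adjacent g) t.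
Proof.
move=> ut; apply/fintype.subsetP/idP => [sub|ct].
  apply: cycle_from_next => // x xt; apply: sub.
  by rewrite mem_cycle_edges // xt eqxx.
by move=> e /imsetP[x xt ->]; apply: (next_cycle ct xt).
Qed.

Lemma cycle_edges_rot i t : uniq t -> cycle_edges (rot i t) = cycle_edges t.
Proof.
move=> ut; apply/setP => e; apply/imsetP/imsetP => -[x xt ->];
  by exists x; rewrite ?mem_rot ?next_rot // -(mem_rot i).
Qed.

Lemma cycle_edges_rev t : uniq t -> cycle_edges (rev t) = cycle_edges t.
Proof.
move=> ut; apply/setP => e; apply/imsetP/imsetP => -[x xt ->].
  exists (prev t x); first by rewrite mem_prev -mem_rev.
  by rewrite next_prev // next_rev // finset.setUC.
exists (next t x); first by rewrite mem_rev mem_next.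
by rewrite next_rev // prev_next // finset.setUC.
Qed.

Lemma next_last x p : uniq (x :: p) -> next (x :: p) (last x p) = x.
Proof. by move=> up; rewrite next_nth mem_last index_last // nth_default. Qed.

(** Any edge of a cycle can be made the closing edge of a rooting of it, in
    either direction. *)
Lemma cycle_from_edge t x y : uniq t -> [set x; y]%SET \in cycle_edges t ->
  exists p, [/\ uniq (x :: p), size (x :: p) = size t, last x p = y &
                cycle_edges (x :: p) = cycle_edges t].
Proof.
move=> + xy; wlog next_y : t xy / x = next t y => [wl ut|ut].
  move: (xy); rewrite mem_cycle_edges // => /andP[xt /orP[]/eqP eqy].
    have xy' : [set x; y]%SET \in cycle_edges (rev t) by rewrite cycle_edges_rev.
    have [||p [up sp lp ep]] := wl _ xy'; rewrite ?rev_uniq //.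
      by rewrite next_rev // eqy prev_next.
    by exists p; split=> //; rewrite ?sp ?size_rev // ep cycle_edges_rev.
  by apply: wl => //; rewrite eqy next_prev.
have yt : y \in t.
  by move: xy; rewrite finset.setUC mem_cycle_edges // => /andP[].
have xt : x \in t by rewrite next_y mem_next.
have [i p def_p] := rot_to xt.
have up : uniq (x :: p) by rewrite -def_p rot_uniq.
exists p; split=> //; first by rewrite -def_p size_rot.
  rewrite -[LHS](prev_next up) next_last //.
  by rewrite -def_p prev_rot // next_y prev_next.
by rewrite -def_p cycle_edges_rot.
Qed.

Lemma next_next_neq t x : uniq t -> 3 <= size t -> x \in t ->
  next t (next t x) != x.
Proof.
move=> ut sz_t xt; have [i p def_p] := rot_to xt.
rewrite -!(next_rot i ut) def_p.
have : uniq (x :: p) by rewrite -def_p rot_uniq.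
have : 3 <= size (x :: p) by rewrite -def_p size_rot.
case: p {def_p} => [|y [|z p]] // _ /= /andP[+ /andP[+ _]].
rewrite !inE !negb_or => /and3P[xy xz _] _.
by rewrite eqxx (eq_sym y) (negPf xy) eqxx eq_sym.
Qed.

(** The edge set, the first and the last vertex determine a rooted oriented
    cycle: walking along the edges there is never a choice. *)
Lemma cycle_edges_inj x p p' : uniq (x :: p) -> uniq (x :: p') ->
  2 <= size p -> size p' = size p -> last x p' = last x p ->
  cycle_edges (x :: p') = cycle_edges (x :: p) -> p' = p.
Proof.
move=> up up' sz_p sz_p' lp ep.
set t := x :: p in up ep; set t' := x :: p' in up' ep.
(* After [z] both cycles continue along an edge other than the one that led
   to the current vertex. *)
have step z : z \in t -> next t z = next t' z ->
    next t (next t z) = next t' (next t z).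
  move=> zt eqz; have zt1 : next t z \in t by rewrite mem_next.
  have : [set next t z; next t (next t z)]%SET \in cycle_edges t'.
    by rewrite ep mem_cycle_edges // zt1 eqxx.
  rewrite mem_cycle_edges // => /andP[_ /orP[/eqP //|/eqP]].
  by rewrite {2}eqz prev_next // => /eqP; rewrite (negPf (next_next_neq _ _ _)).
pose it i := iter i (next t) (last x p).
have eq_iter i : [/\ it i \in t, next t (it i) = next t' (it i) &
    iter i (next t') (last x p) = it i].
  elim: i => [|i [zt eqz eqi]].
    split=> //; first exact: mem_last.
    by rewrite [it 0]/= (next_last up) -lp (next_last up').
  rewrite [it i.+1]iterS -/(it i) iterS eqi -eqz mem_next zt.
  by split=> //; apply: step.
have tr q : uniq (x :: q) -> q = traject (next (x :: q)) (next (x :: q) x) (size q).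
  move=> uq; apply: fpathE; have := cycle_next uq.
  by rewrite /= rcons_path => /andP[].
rewrite [LHS]tr // [RHS]tr // sz_p'.
apply: (@eq_from_nth _ x) => [|i]; rewrite !size_traject // => i_lt.
have [_ _] := eq_iter i.+2; rewrite /it !iterSr.
rewrite (next_last up) -{1}lp (next_last up') => eqi.
rewrite (set_nth_default (next t' x)) ?size_traject // nth_traject //.
by rewrite (set_nth_default (next t x)) ?size_traject // nth_traject.
Qed.

(** A rooting is determined by its two end vertices, which can be any ordered
    pair of adjacent vertices of the cycle. *)
Lemma card_cycle_rootings k c : uniq c -> size c = k -> 3 <= k ->
  #|[set t : k.-tuple 'I_n | uniq t && (cycle_edges t == cycle_edges c)]%SET| =
  2 * k.
Proof.
case: k => // k uc sz_c k3; set D := [set t | _]%SET.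
have x0 : 'I_n by case: c sz_c k3 {uc D} => [|x c] //= <-.
pose ends (t : k.+1.-tuple 'I_n) := (head x0 t, last x0 t).
rewrite -(@card_in_imset _ _ ends D) => [|t t']; last first.
  case/tupleP: t => x p; case/tupleP: t' => x' p'; rewrite !finset.inE.
  move=> /andP[up /eqP ep] /andP[up' /eqP ep'] [eqx]; move: ep' up'.
  rewrite -{x'}eqx /= => ep' up' lp; apply: val_inj => /=; congr cons.
  by apply: (@cycle_edges_inj x) => //; rewrite ?size_tuple // ep.
have -> : ends @: D = [set z : 'I_n * 'I_n |
    (z.1 \in c) && ((z.2 == next c z.1) || (z.2 == prev c z.1))]%SET.
  apply/setP => -[x y]; rewrite finset.inE -mem_cycle_edges //=.
  apply/imsetP/idP => [[t]|].
    rewrite finset.inE => /andP[ut /eqP et] [-> ->]; rewrite -et.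
    have: size t = k.+1 := size_tuple t.
    case: (tval t) ut => [|z p] up /= sz_p; first by rewrite -sz_p in k3.
    by rewrite finset.setUC mem_cycle_edges // mem_last next_last // eqxx.
  case/(cycle_from_edge uc) => p [up sz_p lp ep].
  have szP : size (x :: p) == k.+1 by rewrite sz_p sz_c.
  exists (Tuple szP); first by rewrite finset.inE up ep eqxx.
  by rewrite /ends /= -lp.
rewrite -sum1dep_card -(pair_big_dep (fun x => x \in c)
  (fun x y => (y == next c x) || (y == prev c x)) (fun _ _ => 1)) /=.
rewrite (eq_bigr (fun=> 2)) => [|x xc].
  rewrite sum_nat_const mulnC; congr (_ * _).
  by rewrite -sz_c; apply/card_uniqP.
rewrite sum1dep_card (_ : [set y | _]%SET = [set next c x; prev c x]%SET).
  rewrite cards2 (_ : next c x != prev c x) //.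
  apply: contraNneq (next_next_neq uc _ xc) => [->|]; last by rewrite sz_c.
  by rewrite next_prev.
by apply/setP => y; rewrite !finset.inE.
Qed.

Lemma is_cycleP k (F : {set {set 'I_n}}) :
  reflect (exists t : seq 'I_n, [/\ size t = k, uniq t & F = cycle_edges t])
          (is_cycle k F).
Proof.
apply: (iffP existsP) => [[t /andP[ut /eqP ->]]|[t [st ut ->]]].
  by exists t; rewrite size_tuple.
have szP : size t == k by rewrite st.
by exists (Tuple szP); rewrite ut eqxx.
Qed.

(** A [k]-cycle subgraph can be rooted and oriented in [2 * k] ways. *)
Lemma count_simple_cycleE k g : 3 <= k ->
  sumseq k (fun c => simple_cycle g c) = 2 * k * cycle_count k g.
Proof.
move=> k3; rewrite sumseq_tuple.
set CS := [set F : {set {set 'I_n}} | (F \subset edges g) && is_cycle k F]%SET.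
rewrite -[cycle_count k g]/#|CS| -sum1_card big_distrr /= muln1.
transitivity (\sum_(t : k.-tuple 'I_n | simple_cycle g t) 1).
  by rewrite [RHS]big_mkcond; apply: eq_bigr => t _; case: simple_cycle.
rewrite (partition_big (fun t : k.-tuple 'I_n => cycle_edges t) (mem CS)) /=.
  apply: eq_bigr => F; rewrite finset.inE => /andP[Fg /is_cycleP[c [sc uc def_F]]].
  rewrite -(card_cycle_rootings uc sc k3) sum1dep_card; apply: eq_card => t.
  rewrite !finset.inE /simple_cycle -def_F.
  case: (boolP (uniq t)) => //= ut; case: eqP => [eF|]; last by rewrite andbF.
  by rewrite -cycle_edges_sub // eF Fg.
move=> t /andP[ut ct]; rewrite finset.inE cycle_edges_sub // ct.
by apply/existsP; exists t; rewrite ut eqxx.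
Qed.

End CycleEdges.

(** * Short cycles after a switch *)

Section Structure.
Variables (n : nat) (v0 : 'I_n).
Implicit Types (g h : sgraph n) (s t u c w p q : seq 'I_n) (x y z : 'I_n).

(** The positions [i], [j] and the numbers [l] of inner vertices of the detours
    off a path with [m] vertices that can spoil a switch.  A cycle that follows
    the path from its vertex 1 up to the vertex [i] has spent [i - 1] edges
    there and one on the new edge, so at most [r - i] edges are left for the
    detour; from the vertex 0 there are [r - 1], as the edge removed or added
    there is part of the cycle.  The second alternative is the same for cycles
    through the edge removed at the other end of the path. *)
Definition detour_range r m i j l :=
  [&& i < j, j < m & (l.+1 + maxn 1 i <= r) || (j.+1 == m) && (l.+2 <= r)].

Definition has_detour r g w :=
  exists i j u, detour_range r (size w) i j (size u) && excursion v0 g w i j u.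

(** A detour may be found in either direction; only the positions of its ends
    matter. *)
Lemma detour_intro r g w x z q : uniq w -> x \in w -> z \in w -> x != z ->
  uniq q -> ~~ has (mem w) q -> path (adjacent g) x (rcons q z) ->
  (q = [::] -> (index x w).+1 != index z w /\ (index z w).+1 != index x w) ->
  ((size q).+1 + maxn 1 (minn (index x w) (index z w)) <= r) ||
    ((maxn (index x w) (index z w)).+1 == size w) && ((size q).+2 <= r) ->
  has_detour r g w.
Proof.
move=> uw; wlog ltxz : x z q / index x w < index z w => [wl xw zw xz uq qw pq|].
  have /or3P[ltxz|ltzx|/eqP eqxz] : [|| index x w < index z w,
      index z w < index x w | index x w == index z w] by lia.
  - exact: (wl x z q).
  - move=> cons; rewrite (minnC (index x w)) (maxnC (index x w)) => rg; apply: (wl z x (rev q)) => //.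
    + by rewrite eq_sym.
    + by rewrite rev_uniq.
    + by rewrite has_rev.
    + have := rev_path (adjacent g) x (rcons q z).
      rewrite last_rcons belast_rcons rev_cons => ->.
      by rewrite (eq_path (e' := adjacent g)) // => a b; rewrite adjacentC.
    + by move/(congr1 rev); rewrite revK => /cons[-> ->].
    + by rewrite size_rev.
  - by move: xz; rewrite -(nth_index v0 xw) eqxz nth_index // eqxx.
move=> xw zw xz uq qw pq cons rg; exists (index x w), (index z w), q.
rewrite /detour_range ltxz index_mem zw /=.
move: rg; rewrite (minn_idPl (ltnW ltxz)) (maxn_idPr (ltnW ltxz)) => -> /=.
rewrite /excursion !nth_index // pq cat_uniq uw qw uq /=.
case: q cons {uq qw pq} => [|a q] cons /=; last lia.
by have [+ _] := cons (erefl _); lia.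
Qed.

Lemma first_hit w x p : p != [::] -> last x p \in w ->
  exists q z s, [/\ p = q ++ z :: s, z \in w & ~~ has (mem w) q].
Proof.
move=> pN0 lp; have hw : has (mem w) p.
  apply/hasP; exists (last x p) => //.
  by case: p pN0 {lp} => // a p _; apply: (mem_last a p).
case: {-}_ / (split_find hw) => z q s zw qw.
by exists q, z, s; rewrite cat_rcons.
Qed.

Lemma diverge x p c : p <> c -> uniq (x :: p) -> uniq (x :: c) ->
  last x p = last x c ->
  exists s z p' z' c', [/\ p = s ++ z :: p', c = s ++ z' :: c' & z != z'].
Proof.
elim: p x c => [|z p IHp] x [|z' c] //.
- by move=> _ _ /andP[+ _] /= eqx; rewrite eqx mem_last.
- by move=> _ /andP[+ _] _ /= eqx; rewrite -eqx mem_last.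
have [<-|neqz] := eqVneq z z'; last first.
  by exists [::], z, p, z', c.
move=> nepc /andP[_ up] /andP[_ uc] lpc.
have [|s [z1 [p' [z1' [c' [-> -> ne1]]]]]] := IHp z c _ up uc lpc.
  by move=> eqp; apply: nepc; rewrite eqp.
by exists (z :: s), z1, p', z1', c'.
Qed.

Lemma cycle_edges_cycle t : uniq t ->
  cycle (fun x y => [set x; y]%SET \in cycle_edges t) t.
Proof.
move=> ut; apply: cycle_from_next => // x xt.
by rewrite mem_cycle_edges // xt eqxx.
Qed.

(** A cycle that contains the edge [x y], with [y] on [w], leads from [x] to [y]
    by another way, whose first vertex on [w] ends a detour. *)
Lemma cycle_detour g w (F : {set {set 'I_n}}) j x y : 3 <= j ->
  y \in w -> F \subset edges g -> is_cycle j F -> [set x; y]%SET \in F ->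
  exists z q, [/\ z \in w, [&& x != z, uniq q & ~~ has (mem w) q],
    path (adjacent g) x (rcons q z), (q = [::] -> z != y) & (size q).+2 <= j].
Proof.
move=> j3 yw Fg /is_cycleP[t [sz_t ut def_F]].
rewrite def_F => /(cycle_from_edge ut)[p [up sz_p lp ep]].
have cp : cycle (adjacent g) (x :: p) by rewrite -cycle_edges_sub // ep -def_F.
have pp : path (adjacent g) x p by move: cp; rewrite /= rcons_path => /andP[].
have pN0 : p != [::] by rewrite -size_eq0; move: sz_p; rewrite /= sz_t; lia.
have [|q [z [s [def_p zw qw]]]] := @first_hit w x p pN0; first by rewrite lp.
exists z, q; move: up; rewrite def_p cons_uniq mem_cat inE cat_uniq !negb_or.
case/andP=> /and3P[_ xz _] /and4P[uq _ zs _]; rewrite xz uq qw; split=> //.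
- by move: pp; rewrite def_p -cat_rcons cat_path => /andP[].
- move=> q0; apply: contraNneq zs => eqz.
  move: lp sz_p; rewrite def_p q0 /= sz_t -eqz.
  case: s {def_p} => [_ eqj|b s <- _]; last exact: (mem_last b s).
  by move: j3; rewrite -eqj.
by move: sz_p; rewrite def_p /= size_cat /= sz_t; lia.
Qed.

Lemma path_off (e e' : rel 'I_n) w x q z :
  (forall a b, (a \notin w) || (b \notin w) -> e a b = e' a b) ->
  x \notin w -> ~~ has (mem w) q -> path e x (rcons q z) = path e' x (rcons q z).
Proof.
move=> eqe; elim: q x => [|a q IHq] x xw /=; first by rewrite eqe // xw.
by case/norP=> aw qw; rewrite eqe ?xw // IHq.
Qed.

Section SwitchPath.
Variables (h : sgraph n) (r : nat) (x y : 'I_n) (c : seq 'I_n).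
Let w := x :: rcons c y.
Let b := head x c.
Let e := last y c.
Let g := switch h x b y e.
Hypotheses (c3 : 3 <= size c) (cr : size c <= r).
Hypotheses (pw : simple_path h w) (Nw : ~ has_detour r h w).

Let uw : uniq w. Proof. by case/andP: pw. Qed.
Let bc : b \in c. Proof. by rewrite /b; case: (c) c3 => // a s _; rewrite mem_head. Qed.
Let ec : e \in c. Proof. by rewrite /e; case: (c) c3 => // a s _; exact: (mem_last a s). Qed.
Let cw z : z \in c -> z \in w.
Proof. by move=> zc; rewrite /w in_cons mem_rcons in_cons zc !orbT. Qed.
Let xw : x \in w. Proof. exact: mem_head. Qed.
Let yw : y \in w. Proof. by rewrite /w in_cons mem_rcons mem_head orbT. Qed.
Let xNc : x \notin c.
Proof. by move: uw; rewrite /w /= mem_rcons inE negb_or => /andP[/andP[]]. Qed.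
Let yNc : y \notin c.
Proof. by move: uw; rewrite /w /= rcons_uniq => /and3P[]. Qed.
Let uc : uniq c.
Proof. by move: uw; rewrite /w /= rcons_uniq => /and3P[]. Qed.
Let xNy : x != y.
Proof. by move: uw; rewrite /w /= mem_rcons inE negb_or => /andP[/andP[]]. Qed.
Let bNe : b != e.
Proof.
move: uc c3; rewrite /b /e; case: (c) => [|a [|a' s]] //= /andP[+ _] _.
by apply: contraNneq => ->; rewrite mem_last.
Qed.
Let neq_in z z' : z' \in c -> z \notin c -> z != z'.
Proof. by move=> zc; apply: contraNneq => ->. Qed.

Let xb : adjacent h x b.
Proof. by case/andP: pw => _; rewrite /w /b; case: (c) c3 => //= a s _ /andP[]. Qed.
Let ye : adjacent h y e.
Proof.
case/andP: pw => _; rewrite /w /e [sorted _ _]/= rcons_path => /andP[_].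
by rewrite adjacentC; case: (c) c3.
Qed.

Let index_x : index x w = 0. Proof. by rewrite /w /= eqxx. Qed.
Let size_w : size w = (size c).+2. Proof. by rewrite /w /= size_rcons. Qed.
Let index_c z : z \in c -> index z w = (index z c).+1.
Proof.
move=> zc; rewrite /w /= ifN; last by rewrite neq_in.
by rewrite -cats1 index_cat zc.
Qed.
Let index_y : index y w = (size c).+1.
Proof.
by rewrite /w /= (negPf xNy) -cats1 index_cat (negPf yNc) /= eqxx addn0.
Qed.
Let index_b : index b w = 1.
Proof. by rewrite index_c // /b; case: (c) c3 => //= a s; rewrite eqxx. Qed.
Let index_e : index e w = size c.
Proof.
rewrite index_c // /e; move: uc; case: (c) c3 => // a s _ us.
by rewrite [last _ _]/= index_last.
Qed.

(** The switch replaces the two end edges of the path [x :: rcons c y] by [x y]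
    and [b e], which closes [c] to a cycle.  An existing edge [x y] or [b e]
    would be a detour. *)
Lemma no_detour_switchable : switchable h x b y e.
Proof.
rewrite /switchable xb ye /= !inE !negb_or xNy bNe (eq_sym b y).
rewrite (neq_in bc xNc) (neq_in ec xNc) (neq_in bc yNc) (neq_in ec yNc) /=.
apply/andP; split; apply/negP => adj.
  apply: Nw; apply: (detour_intro (q := [::]) uw xw yw xNy) => // [|_|].
  - by rewrite /= adj.
  - by rewrite index_x index_y; move: c3; clear; lia.
  - by rewrite index_x index_y size_w /=; move: c3 cr; clear; lia.
apply: Nw; apply: (detour_intro (q := [::]) uw (cw bc) (cw ec) bNe) => // [|_|].
- by rewrite /= adj.
- by rewrite index_b index_e; move: c3; clear; lia.
- by rewrite index_b index_e /=; move: c3 cr; clear; lia.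
Qed.

Let sw := no_detour_switchable.

Let adj_off (u v : 'I_n) : (u \notin w) || (v \notin w) ->
  adjacent g u v = adjacent h u v.
Proof.
move=> uvw; rewrite (adjacent_switch _ _ sw).
have off a a' : a \in w -> a' \in w -> same_pair u v a a' = false.
  move=> aw a'w; apply/negP => /orP[] /andP[/eqP eu /eqP ev];
  by move: uvw; rewrite eu ev aw a'w.
rewrite (off _ _ xw (cw bc)) (off _ _ yw (cw ec)) (off _ _ xw yw).
by rewrite (off _ _ (cw bc) (cw ec)) !andbT !orbF.
Qed.

Let neq_index z (t : 'I_n) k : z \in w -> t \in w -> index t w = k -> z != t ->
  index z w != k.
Proof.
move=> zw tw <-; apply: contraNneq => eqi.
by rewrite -(nth_index v0 zw) eqi nth_index.
Qed.

Lemma cycle_avoids_x (F : {set {set 'I_n}}) j : 3 <= j <= r ->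
  F \subset edges h -> is_cycle j F -> [set x; b]%SET \notin F.
Proof.
case/andP=> j3 jr Fh cF; apply/negP => xF; apply: Nw.
have [z [q [zw /and3P[xz uq qw] pq zb sq]]] := cycle_detour j3 (cw bc) Fh cF xF.
apply: (detour_intro uw xw zw xz uq qw pq) => [q0|].
  rewrite index_x eq_sym; split=> //.
  exact: (neq_index zw (cw bc) index_b (zb q0)).
by rewrite index_x min0n; apply/orP; left; move: sq jr; clear; lia.
Qed.

Lemma cycle_avoids_y (F : {set {set 'I_n}}) j : 3 <= j <= r ->
  F \subset edges h -> is_cycle j F -> [set y; e]%SET \notin F.
Proof.
case/andP=> j3 jr Fh cF; apply/negP => yF; apply: Nw.
have [z [q [zw /and3P[yz uq qw] pq ze sq]]] := cycle_detour j3 (cw ec) Fh cF yF.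
have lez : index z w <= (size c).+1 by rewrite -ltnS -size_w index_mem.
apply: (detour_intro uw yw zw yz uq qw pq) => [q0|].
  rewrite index_y eqSS; split; first by move: lez; clear; lia.
  exact: (neq_index zw (cw ec) index_e (ze q0)).
by rewrite index_y (maxn_idPl lez) size_w eqxx /= (leq_trans sq) ?orbT.
Qed.

(** Up to its first return to the path, a cycle through [x y] cannot use the
    other new edge, so that this part of it exists before the switch. *)
Lemma new_cycle_avoids_xy (F : {set {set 'I_n}}) j : 3 <= j <= r ->
  F \subset edges g -> is_cycle j F -> [set x; y]%SET \notin F.
Proof.
case/andP=> j3 jr Fg cF; apply/negP => xF; apply: Nw.
have [z [q [zw /and3P[xz uq qw] pq zy sq]]] := cycle_detour j3 yw Fg cF xF.
have [{}pq zb] : path (adjacent h) x (rcons q z) /\ (q = [::] -> z != b).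
  case: q uq qw pq zy sq => [|a q] uq qw pq zy sq; last first.
    split=> //; move: pq; rewrite !rcons_cons /= => /andP[xa pq].
    move: qw => /= /norP[aw qw]; rewrite -adj_off ?aw ?orbT // xa /=.
    by rewrite -(@path_off (adjacent g) _ w) // => ? ?; apply: adj_off.
  move: pq; rewrite /= !andbT (adjacent_switch _ _ sw).
  case/or3P=> [/and3P[-> + _]| |].
  - rewrite /same_pair eqxx => zb; split=> // _.
    by apply: contraNneq zb => ->; rewrite eqxx.
  - by rewrite /same_pair eqxx (negPf xNy) (negPf (zy (erefl _))).
  - by rewrite /same_pair !(negPf (neq_in _ xNc)).
apply: (detour_intro uw xw zw xz uq qw pq) => [q0|].
  rewrite index_x eq_sym; split=> //.
  exact: (neq_index zw (cw bc) index_b (zb q0)).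
by rewrite index_x min0n; apply/orP; left; move: sq jr; clear; lia.
Qed.

Let c_def : c = b :: behead c.
Proof. by rewrite /b; case: (c) c3. Qed.

Let lc : last b (behead c) = e.
Proof. by rewrite /b /e; case: (c) c3. Qed.

(** A cycle through the new edge [b e] other than [c] leaves [c] somewhere and
    has to come back to the path. *)
Lemma new_cycle_through_be (F : {set {set 'I_n}}) j : 3 <= j <= r ->
  F \subset edges g -> is_cycle j F -> [set b; e]%SET \in F ->
  j = size c /\ F = cycle_edges c.
Proof.
move=> j3r Fg cF; have xyF := new_cycle_avoids_xy j3r Fg cF.
case/andP: j3r => j3 jr beF.
have [t [sz_t ut def_F]] := is_cycleP _ _ cF.
move: beF; rewrite def_F => /(cycle_from_edge ut)[p [up sz_p lp ep]].
rewrite -def_F in ep *; rewrite sz_t in sz_p.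
have [eqp|/eqP nep] := eqVneq p (behead c).
  by rewrite -sz_p -ep eqp -c_def.
case: Nw.
have eF (u v : 'I_n) : [set u; v]%SET \in F -> ~~ same_pair u v b e ->
    adjacent h u v.
  move=> uvF Nbe; move: (fintype.subsetP Fg _ uvF).
  rewrite -/(adjacent g u v) (adjacent_switch _ _ sw) (negPf Nbe) orbF.
  case/orP=> [/andP[] //|]; rewrite -eq_set2 => /eqP eq_uv.
  by rewrite -eq_uv uvF in xyF.
have pF : path (fun u v : 'I_n => [set u; v]%SET \in F) b p.
  by have := cycle_edges_cycle up; rewrite ep /= rcons_path => /andP[].
have pg : path (adjacent g) b p.
  by apply: sub_path pF => u v; apply: (fintype.subsetP Fg).
have ph : path (adjacent h) b p.
  case: p up sz_p lp pF {pg nep ep} => // p1 p2 up sz_p lp /= /andP[bp1 pF].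
  apply/andP; split.
    apply: (eF _ _ bp1); rewrite /same_pair eqxx (negPf bNe) /= orbF.
    apply: contraTneq up => p1e; move: lp sz_p; rewrite /= p1e.
    case: (p2) => [|p3 p4] /= lp sz_p; first by move: j3; rewrite -sz_p.
    by rewrite -lp mem_last !andbF.
  apply: (@sub_in_path _ (predC1 b) _ _ _ _ _ _ pF) => [u v /= ub vb uvF|].
    by apply: (eF _ _ uvF); rewrite /same_pair (negPf ub) (negPf vb) andbF.
  apply/allP => u; rewrite /= inE => up'; apply: contraTneq up => <-.
  by rewrite /= inE up'.
have uc' : uniq (b :: behead c) by rewrite -c_def.
have [|s [z [p' [z' [c' [def_p def_c zz']]]]]] := diverge nep up uc'.
  by rewrite lp lc.
have bsc : {subset b :: s <= c}.
  by move=> u; rewrite c_def def_c !inE mem_cat => /orP[->|->]; rewrite ?orbT.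
have x1c : last b s \in c by apply: bsc; apply: mem_last.
have ux : uniq ((b :: s) ++ z :: p') by rewrite /= -def_p.
have ucs : uniq ((b :: s) ++ z' :: c') by rewrite /= -def_c.
have z'c : z' \in c by rewrite c_def def_c inE mem_cat mem_head !orbT.
have index_s s1 s2 : s = s1 ++ s2 -> index (last b s1) w = (size s1).+1.
  move=> def_s; have lc1 : last b s1 \in b :: s1 by apply: mem_last.
  rewrite index_c; last first.
    apply: bsc; rewrite def_s inE mem_cat; move: lc1.
    by rewrite inE => /orP[->|->]; rewrite ?orbT.
  rewrite c_def def_c def_s -catA -cat_cons index_cat lc1 index_last //.
  by move: ucs; rewrite def_s cat_cons -catA -cat_cons cat_uniq => /andP[].
have index_x1 := index_s s [::] (esym (cats0 s)).
have index_z' : index z' w = (size s).+2.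
  rewrite index_c // c_def def_c -cat_cons index_cat ifN /= ?eqxx ?addn0 //.
  by move: ucs; rewrite uniq_catC /= mem_cat negb_or => /andP[/andP[]].
have phz : path (adjacent h) (last b s) (z :: p').
  by move: ph; rewrite def_p cat_path => /andP[].
have lz : last (last b s) (z :: p') = e by rewrite -last_cat -def_p.
have [||q [z1 [s2 [def_zp zw qw]]]] := @first_hit w (last b s) (z :: p') => //.
  by rewrite lz cw.
have Nbs (u : 'I_n) : u \in z :: p' -> u \notin b :: s.
  move=> uz; move: ux; rewrite cat_uniq => /and3P[_ /hasPn Hn _].
  exact: Hn.
have z1z : z1 \in z :: p' by rewrite def_zp mem_cat mem_head orbT.
have x1z1 : last b s != z1.
  by apply: contraNneq (Nbs _ z1z) => <-; apply: mem_last.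
have uq : uniq q.
  by move: ux; rewrite cat_uniq def_zp cat_uniq => /and3P[_ _ /andP[]].
have pq : path (adjacent h) (last b s) (rcons q z1).
  by move: phz; rewrite def_zp -cat_rcons cat_path => /andP[].
apply: (detour_intro uw (cw x1c) zw x1z1 uq qw pq) => [q0|].
  have eqz : z1 = z by move: def_zp; rewrite q0 => -[].
  rewrite eqz in zw z1z *; rewrite index_x1 eqSS; split.
    by rewrite eq_sym; apply: (neq_index zw (cw z'c) index_z' zz').
  have [s0|[s1 [x2 def_s]]] : s = [::] \/ exists s1 x2, s = rcons s1 x2.
    by case/lastP: (s) => [|s1 x2]; [left | right; exists s1, x2].
  - rewrite s0; apply: (neq_index zw xw index_x).
    have: adjacent g b z by move: pg; rewrite def_p s0 /= => /andP[].
    rewrite (adjacent_switch _ _ sw); apply: contraTneq => ->.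
    rewrite /same_pair !eqxx (eq_sym b x) (eq_sym b y) (negPf bNe).
    rewrite (negPf (neq_in bc xNc)) (negPf (neq_in bc yNc)) (negPf xNy).
    by rewrite (negPf (neq_in ec xNc)) !andbF.
  (* Where the cycle leaves [c], it does not turn back. *)
  have eqs := index_s s1 [:: x2] (esym (etrans (cats1 s1 x2) (esym def_s))).
  have sc : last b s1 \in b :: s.
    by rewrite def_s -rcons_cons mem_rcons inE mem_last orbT.
  rewrite {1}def_s size_rcons.
  apply: (neq_index zw (cw (bsc _ sc)) eqs).
  by apply: contraNneq (Nbs _ z1z) => ->.
apply/orP; left; rewrite index_x1.
have: size (z :: p') = size q + (size s2).+1 by rewrite def_zp size_cat.
move: sz_p; rewrite def_p /= size_cat /=; move: jr; clear.
by move: (index _ _); lia.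
Qed.

Let path_sub_c : cycle_edges c \subset edges g.
Proof.
rewrite cycle_edges_sub // c_def.
have pc : path (adjacent h) b (behead c).
  case/andP: pw => _; rewrite /w c_def /= rcons_path => /and3P[_ + _].
  by rewrite -/(behead _).
rewrite /= rcons_path; apply/andP; split; last first.
  rewrite lc.
  by rewrite (adjacent_switch _ _ sw) /same_pair !eqxx !orbT.
apply: (@sub_in_path _ (mem c) _ _ _ _ _ _ pc) => [u v uc' vc uv|]; last first.
  by apply/allP => u; rewrite /= -c_def.
rewrite (adjacent_switch _ _ sw) uv; apply/orP; left => /=.
have ne z z' : z \in c -> z' \notin c -> (z == z') = false.
  by move=> zc z'c; rewrite eq_sym (negPf (neq_in zc z'c)).
by rewrite /same_pair !(ne _ x) // !(ne _ y) // !andbF.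
Qed.

Let c_not_in_h : ~~ (cycle_edges c \subset edges h).
Proof.
rewrite cycle_edges_sub // c_def /= rcons_path negb_and.
rewrite lc.
by case/and5P: sw => _ _ _ _; rewrite adjacentC => ->; rewrite orbT.
Qed.

(** Without detours, no short cycle is destroyed and only [c] is created. *)
Lemma no_detour_cycle_count j : 3 <= j <= r ->
  cycle_count j g = cycle_count j h + (j == size c).
Proof.
move=> j3r; rewrite /cycle_count.
set S := [set F : {set {set 'I_n}} | (F \subset edges h) && is_cycle j F]%SET.
have -> : [set F : {set {set 'I_n}} | (F \subset edges g) && is_cycle j F]%SET =
    if j == size c then (cycle_edges c |: S)%SET else S.
  apply/setP => F; rewrite finset.inE.
  have -> : (F \in if j == size c then (cycle_edges c |: S)%SET else S) =
      (j == size c) && (F == cycle_edges c) || (F \in S).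
    by case: (j == size c); rewrite ?finset.inE.
  apply/andP/orP => [[Fg cF]|[/andP[/eqP eqj /eqP eqF]|]].
  - have [beF|NbeF] := boolP ([set b; e]%SET \in F).
      have [-> ->] := new_cycle_through_be j3r Fg cF beF.
      by left; rewrite !eqxx.
    right; rewrite finset.inE cF andbT; apply/fintype.subsetP => f fF.
    have := fintype.subsetP Fg _ fF => fg.
    have /eqP/cards2P[u [v [_ def_f]]] := edge_card2 fg.
    move: fg; rewrite def_f -/(adjacent g u v) (adjacent_switch _ _ sw).
    case/or3P=> [/andP[] //||]; rewrite -eq_set2 => /eqP eq_f.
      have := new_cycle_avoids_xy j3r Fg cF.
      by rewrite -eq_f -def_f fF.
    by rewrite -eq_f -def_f fF in NbeF.
  - rewrite eqF path_sub_c; split=> //.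
    by apply/is_cycleP; exists c; rewrite eqj.
  - rewrite finset.inE => /andP[Fh cF]; split=> //.
    apply/fintype.subsetP => f fF; have fh := fintype.subsetP Fh _ fF.
    have /eqP/cards2P[u [v [_ def_f]]] := edge_card2 fh.
    move: fh; rewrite def_f -/(adjacent g u v) -/(adjacent h u v) => uv.
    rewrite (adjacent_switch _ _ sw) uv /= -!eq_set2 -def_f.
    apply/orP; left; apply/andP; split.
      by apply: contraNneq (cycle_avoids_x j3r Fh cF) => <-.
    by apply: contraNneq (cycle_avoids_y j3r Fh cF) => <-.
case: (j == size c); last by rewrite addn0.
rewrite cardsU1 addnC; congr (_ + _).
by rewrite finset.inE negb_and c_not_in_h.
Qed.

End SwitchPath.
End Structure.

(** * Counting the good switches *)

Section GoodPaths.
Variables (n d r : nat).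
Implicit Types (g h : sgraph n) (u c w : seq 'I_n) (x y : 'I_n).

(** Among the cycles of length at most [r], the switch changes the counts only
    by the creation of [c]. *)
Definition good_path h x c y :=
  [&& simple_path h (x :: rcons c y), switchable h x (head x c) y (last y c) &
      [forall j : 'I_r.+1, (3 <= j) ==>
         (cycle_count j (switch h x (head x c) y (last y c)) ==
          cycle_count j h + (j == size c :> nat))]].

Lemma good_or_detour (v0 : 'I_n) h x c y : 3 <= size c -> size c <= r ->
  simple_path h (x :: rcons c y) <=
  good_path h x c y + \sum_(i < (size c).+2) \sum_(j < (size c).+2) \sum_(l < r)
    (detour_range r (size c).+2 i j l) *
    (simple_path h (x :: rcons c y) *
     sumseq l (fun u => excursion v0 h (x :: rcons c y) i j u)).
Proof.
move=> c3 cr; case: (boolP (simple_path _ _)) => // pw.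
have [[i [j [u /andP[rg exc]]]]|Nw] := pselect (has_detour v0 r h (x :: rcons c y)).
  move: rg; rewrite /= size_rcons => rg; have /and3P[ij jm lr] := rg.
  have ur : size u < r by move: lr; clear; lia.
  rewrite (bigD1 (Ordinal (ltn_trans ij jm))) //= (bigD1 (Ordinal jm)) //=.
  rewrite (bigD1 (Ordinal ur)) //= rg !mul1n -!addnA.
  set S := sumseq _ _; suff : 0 < S by move: S; clear; lia.
  by apply: leq_trans (sumseq_ge _ (erefl (size u))); rewrite exc.
suff -> : good_path h x c y by [].
rewrite /good_path pw (no_detour_switchable c3 cr pw Nw) /=.
apply/forallP => j; apply/implyP => j3; apply/eqP.
by apply: (no_detour_cycle_count c3 cr pw Nw); rewrite j3 -ltnS ltn_ord.
Qed.

Definition geometric q L := \sum_(l < L) q ^ l.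

Lemma geometricS q L : geometric q L.+1 = (q * geometric q L).+1.
Proof.
rewrite /geometric big_ord_recl expn0 add1n big_distrr /=; congr _.+1.
by apply: eq_bigr => i _; rewrite -expnS.
Qed.

Lemma geometric_le q L : 2 <= q -> geometric q L.+1 <= 2 * q ^ L.
Proof.
move=> q2; elim: L => [|L IHL]; first by rewrite /geometric big_ord1.
rewrite /geometric big_ord_recr /= -/(geometric q L.+1).
apply: leq_trans (leq_add IHL (leqnn _)) _; rewrite mul2n -addnn mul2n -addnn.
by rewrite leq_add2r addnn -mul2n expnS leq_mul2r q2 orbT.
Qed.

Lemma sum_geometric q R M : 2 <= q ->
  \sum_(i < M) geometric q (R - i.+1) <= 2 * geometric q R.-1.
Proof.
move=> q2; elim: R M => [|R IHR] [|M]; rewrite ?big_ord0 //.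
  by rewrite big1 // => i _; rewrite sub0n /geometric big_ord0.
rewrite big_ord_recl /= subn1 /=; case: R IHR => [|R] IHR.
  rewrite big1 ?addn0 ?leq_pmull // => i _.
  by rewrite subSS sub0n /geometric big_ord0.
apply: leq_trans (leq_add (leqnn _) (IHR M)) _.
rewrite /= geometricS; have : 2 * geometric q R <= q * geometric q R.
  by rewrite leq_mul2r q2 orbT.
by move: (geometric q R) (q * geometric q R); clear; lia.
Qed.

Lemma sum_ord_ltn (F : nat -> nat) M L :
  \sum_(l < M) (l < L) * F l <= \sum_(l < L) F l.
Proof.
rewrite (eq_bigr (fun l : 'I_M => if l < L then F l else 0)); last first.
  by move=> l _; case: ltnP; rewrite ?mul1n.
rewrite -big_mkcond -(big_mkord (fun l => l < L) F) -(big_mkord predT F).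
case: (leqP M L) => [ML|/ltnW LM].
  rewrite [leqRHS](big_cat_nat _ ML) //= (leq_trans _ (leq_addr _ _)) //.
  by rewrite [leqRHS](bigID (fun l => l < L)) /= leq_addr.
rewrite (big_cat_nat _ LM) //= [X in _ + X]big_nat_cond [X in _ + X]big1.
  by rewrite addn0 [leqRHS](bigID (fun l => l < L)) /= leq_addr.
by move=> l /andP[/andP[Ll _]]; rewrite ltnNge Ll.
Qed.

(** The free end of a detour costs the factor [m]; the other end costs only a
    constant, as the lengths allowed shrink when [i] grows. *)
Lemma sum_detour_range q m : 2 <= q -> 2 <= r ->
  \sum_(i < m) \sum_(j < m) \sum_(l < r) detour_range r m i j l * q ^ l <=
  8 * m * q ^ (r - 2).
Proof.
move=> q2 r2; set f := geometric q.
have le_r M : \sum_(l < r) (l.+1 + M <= r) * q ^ l <= f (r - M).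
  apply: leq_trans (sum_ord_ltn (fun l => q ^ l) r (r - M)).
  by apply: leq_sum => l _; rewrite (_ : (l.+1 + M <= r) = (l < r - M)) //; lia.
apply: (@leq_trans (\sum_(i < m) \sum_(j < m)
    (f (r - maxn 1 i) + (j.+1 == m) * f (r - 1)))).
  apply: leq_sum => i _; apply: leq_sum => j _.
  apply: leq_trans (leq_add (le_r (maxn 1 i)) (leq_mul (leqnn _) (le_r 1))).
  rewrite big_distrr -big_split /=; apply: leq_sum => l _.
  rewrite mulnA -mulnDl leq_mul2r /detour_range; apply/orP; right.
  by move: (maxn 1 i) => M; clear; lia.
have sum_j (F G : nat) : \sum_(j < m) (F + (j.+1 == m) * G) <= m * F + G.
  rewrite big_split /= sum_nat_const card_ord leq_add2l -big_distrl /=.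
  case: (m) => [|m']; first by rewrite big_ord0.
  rewrite big_ord_recr /= eqxx big1 ?mul1n // => j _.
  by rewrite eqSS (ltn_eqF (ltn_ord j)).
apply: (@leq_trans (\sum_(i < m) (m * f (r - maxn 1 i) + f (r - 1)))).
  by apply: leq_sum => i _; apply: sum_j.
rewrite big_split /= sum_nat_const card_ord -big_distrr /=.
have sum_i : \sum_(i < m) f (r - maxn 1 i) <= 3 * f (r - 1).
  case: (m) => [|m']; first by rewrite big_ord0.
  rewrite big_ord_recl /= mulSn leq_add //.
  rewrite (eq_bigr (fun i : 'I_m' => f (r - i.+1))) => [|i _].
    by rewrite subn1; apply: sum_geometric.
  by rewrite (maxn_idPr _) // /bump.
have fr : f (r - 1) <= 2 * q ^ (r - 2).
  have -> : r - 1 = (r - 2).+1 by move: r2; clear; lia.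
  exact: geometric_le.
apply: leq_trans (leq_add (leq_mul (leqnn m) sum_i) (leqnn _)) _.
rewrite -mulnDr -mulSnr; apply: (@leq_trans (m * (4 * (2 * q ^ (r - 2))))).
  by rewrite leq_mul2l leq_mul2l fr !orbT.
by rewrite !mulnA leq_mul2r; apply/orP; right; clear; lia.
Qed.

Definition good_total k : nat :=
  \sum_(h in regular_graphs n d) \sum_x
     sumseq k (fun c => \sum_y good_path h x c y).

Hypotheses (d3 : 3 <= d) (nbig : 8 * r + 4 * d <= n).

(** A simple path whose switch is not good has a detour, and the detours of
    each shape are rare. *)
Lemma count_bad k : 3 <= k <= r ->
  \sum_(h in regular_graphs n d) sumseq k.+2 (fun w => simple_path h w) <=
  good_total k + 16 * k.+2 * #|regular_graphs n d| * d.-1 ^ (k + r).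
Proof.
case/andP=> k3 kr.
have v0 : 'I_n by exists 0; move: nbig d3; clear; lia.
set R := regular_graphs n d.
pose bad (i j l : nat) := \sum_(h in R) sumseq k.+2 (fun w =>
     simple_path h w * sumseq l (fun u => excursion v0 h w i j u)).
have le1 : \sum_(h in R) sumseq k.+2 (fun w => simple_path h w) <=
    good_total k + \sum_(i < k.+2) \sum_(j < k.+2) \sum_(l < r)
      detour_range r k.+2 i j l * bad i j l.
  apply: (@leq_trans (\sum_(h in R) (\sum_x
      sumseq k (fun c => \sum_y good_path h x c y) +
     \sum_(i < k.+2) \sum_(j < k.+2) \sum_(l < r)
      detour_range r k.+2 i j l * sumseq k.+2 (fun w =>
     simple_path h w * sumseq l (fun u => excursion v0 h w i j u))))).
    apply: leq_sum => h hR.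
    pose D w := \sum_(i < k.+2) \sum_(j < k.+2) \sum_(l < r)
      detour_range r k.+2 i j l *
        (simple_path h w * sumseq l (fun u => excursion v0 h w i j u)).
    have -> : \sum_(i < k.+2) \sum_(j < k.+2) \sum_(l < r)
      detour_range r k.+2 i j l * sumseq k.+2 (fun w =>
        simple_path h w * sumseq l (fun u => excursion v0 h w i j u)) =
        sumseq k.+2 D.
      rewrite sumseq_big; apply: eq_bigr => i _; rewrite sumseq_big.
      apply: eq_bigr => j _; rewrite sumseq_big; apply: eq_bigr => l _.
      by rewrite -sumseqMl.
    rewrite !sumseq_ends -big_split /=; apply: leq_sum => x _.
    rewrite -sumseqD; apply: leq_sumseq => c sz_c.
    rewrite -big_split /=; apply: leq_sum => y _.
    rewrite /D -sz_c; apply: good_or_detour; rewrite sz_c //.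
  rewrite big_split leq_add2l /= exchange_big /=; apply: leq_sum => i _.
  rewrite exchange_big /=; apply: leq_sum => j _.
  rewrite exchange_big /=; apply: leq_sum => l _.
  by rewrite -big_distrr.
apply: leq_trans le1 _; rewrite leq_add2l.
apply: (@leq_trans (2 * #|R| * d.-1 ^ k.+2 * (\sum_(i < k.+2) \sum_(j < k.+2)
    \sum_(l < r) detour_range r k.+2 i j l * d.-1 ^ l))).
  rewrite big_distrr /=; apply: leq_sum => i _.
  rewrite big_distrr /=; apply: leq_sum => j _.
  rewrite big_distrr /=; apply: leq_sum => l _.
  rewrite mulnCA; case: (boolP (detour_range _ _ _ _ _)) => // rg; rewrite !mul1n.
  rewrite -mulnA -expnD.
  have /and3P[ij jm lr] := rg.
  have [lij|lij] := leqP 2 (j - i + l); last first.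
    rewrite /bad big1 // => h _; rewrite (@eq_sumseq _ _ _ (fun=> 0)).
      by rewrite (sumseqMl k.+2 0 (fun=> 0)).
    move=> w _; rewrite (@eq_sumseq _ _ _ (fun=> 0)).
      by rewrite (sumseqMl l 0 (fun=> 0)) muln0.
    move=> u sz_u; rewrite /excursion sz_u leqNgt lij !andbF //.
  apply: count_excursion => //; first by rewrite ij jm.
    by move: d3; clear; lia.
  move: lr nbig kr; clear; lia.
have q2 : 2 <= d.-1 by move: d3; clear; lia.
have r2 : 2 <= r by move: k3 kr; clear; lia.
apply: leq_trans (leq_mul (leqnn _) (sum_detour_range k.+2 q2 r2)) _.
have -> : k + r = k.+2 + (r - 2) by move: r2; clear; lia.
by rewrite expnD; set A := d.-1 ^ _; set B := d.-1 ^ _; clear; lia.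
Qed.

(** Almost all walks of [k.+1] steps without turning back are good. *)
Lemma good_total_lower k : 3 <= k <= r ->
  #|regular_graphs n d| * (n * d * d.-1 ^ k) <=
  good_total k + 34 * k * #|regular_graphs n d| * d.-1 ^ (k + r).
Proof.
move=> k3r; have /andP[k3 kr] := k3r.
have d0 : 0 < d by move: d3; clear; lia.
have v0 : 'I_n by exists 0; move: nbig d3; clear; lia.
have nbig' : 4 * (k + 2 + d) <= n by move: nbig k3 kr; clear; lia.
apply: leq_trans (count_simple_path_lower v0 d0 nbig') _.
apply: leq_trans (leq_add (count_bad k3r) (leqnn _)) _.
rewrite -addnA leq_add2l.
set N := #|_|; have kq : k * d.-1 ^ k.+1 <= d.-1 ^ (k + r).
  have -> : k + r = (r - 1) + k.+1 by move: k3 kr; clear; lia.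
  rewrite expnD leq_mul2r; apply/orP; right.
  case: k {nbig' k3r} k3 kr => // k k3 kr.
  apply: leq_trans (ltn_expl k (ltnSn 1)) _.
  apply: (@leq_trans (d.-1 ^ k)); first by rewrite leq_exp2r; [move: d3; clear; lia | move: k3; clear; lia].
  by rewrite leq_pexp2l //; move: d3 kr; clear; lia.
set Q := d.-1 ^ (k + r) in kq *; set P := d.-1 ^ k.+1 in kq *.
have -> : 2 * k ^ 2 * N * P = 2 * k * N * (k * P) by rewrite -mulnn; lia.
apply: leq_trans (leq_add (leqnn _) (leq_mul (leqnn _) kq)) _.
rewrite -mulnDl leq_mul2r -mulnDl leq_mul2r; apply/orP; right; apply/orP; right.
by move: k3; clear; lia.
Qed.

(** On average, [2 * k * cycle_count k] exceeds [d.-1 ^ k] only slightly. *)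
Lemma cycle_total_upper k : 3 <= k <= r ->
  n * d * (\sum_(g in regular_graphs n d) 2 * k * cycle_count k g) <=
  #|regular_graphs n d| * (n * d * d.-1 ^ k) +
  24 * k * #|regular_graphs n d| * d.-1 ^ (k + r).
Proof.
case/andP=> k3 kr; have d0 : 0 < d by move: d3; clear; lia.
have nbig' : 4 * (k + d) <= n by move: nbig k3 kr; clear; lia.
rewrite (eq_bigr (fun g => sumseq k (fun c => simple_cycle g c))) => [|g _]; last first.
  by rewrite count_simple_cycleE.
apply: leq_trans (count_simple_cycle n d k3) _; rewrite leq_add2l.
apply: leq_trans (leq_mul (leqnn _) (count_simple_cycle_le k3 d0 nbig')) _.
set N := #|_|; set q := d.-1.
have q1 : 0 < q by move: d3; rewrite /q; clear; lia.
have dq : d <= 2 * q by move: d3; rewrite /q; clear; lia.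
have qr : q ^ 2 <= q ^ r by rewrite leq_pexp2l //; move: k3 kr; clear; lia.
have le_q : (2 * k * d + 2 * d * d) * 2 <= 24 * k * q ^ r.
  apply: (@leq_trans (24 * k * q ^ 2)); last by rewrite leq_mul2l qr orbT.
  have dd : d * d <= 4 * (q * q) by apply: leq_trans (leq_mul dq dq) _; clear; lia.
  have kd : k * d <= 2 * (k * (q * q)).
    rewrite mulnCA leq_mul2l; apply/orP; right; apply: leq_trans dq _.
    by rewrite leq_mul2l /= leq_pmulr.
  have kqq : q * q <= k * (q * q) by rewrite leq_pmull //; move: k3; clear; lia.
  by rewrite -mulnn; move: dd kd kqq; clear; lia.
rewrite (expnD q) [leqRHS](_ : _ = 24 * k * q ^ r * (N * q ^ k)); last by clear; lia.
rewrite [leqLHS](_ : _ = (2 * k * d + 2 * d * d) * 2 * (N * q ^ k)); last by clear; lia.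
by rewrite leq_mul2r le_q orbT.
Qed.

End GoodPaths.

(** * The Stein equation of a Poisson law *)

(** What is used of the Poisson law [p] with mean [s ^+ 2]. *)
Record poisson_law (R : realFieldType) (s : R) (p : nat -> R) : Prop :=
  PoissonLaw {
    law_ge1 : (1 <= s)%R;
    law_gt0 : forall i, (0 < p i)%R;
    law_rec : forall i, (s ^+ 2 * p i = i.+1%:R * p i.+1)%R;
    law_sum_le1 : forall m, (\sum_(i < m) p i <= 1)%R;
    law_sum_sup : forall b : R, (forall m, \sum_(i < m) p i <= b)%R -> (1 <= b)%R
  }.

Section Stein.
Local Open Scope ring_scope.
Variables (R : realFieldType) (s : R) (p : nat -> R).
Hypothesis law : poisson_law s p.

Local Notation p_gt0 := (law_gt0 law).
Local Notation p_rec := (law_rec law).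
Local Notation p_sum_le1 := (law_sum_le1 law).
Local Notation p_sum_sup := (law_sum_sup law).

Let s2_gt0 : 0 < s ^+ 2.
Proof. by apply: exprn_gt0; apply: lt_le_trans (law_ge1 law). Qed.

Lemma p_next i : p i.+1 = s ^+ 2 / i.+1%:R * p i.
Proof.
have s_ge1 := law_ge1 law.
have i0 : (i.+1%:R : R) != 0 by rewrite pnatr_eq0.
by rewrite mulrAC p_rec mulrAC divff // mul1r.
Qed.

(** Up to [j] the ratio of consecutive terms is at most [j%:R / s ^+ 2], so a
    geometric series bounds the sum. *)
Lemma p_head_far j : (j%:R : R) < s ^+ 2 ->
  \sum_(i < j.+1) p i <= p j * (s ^+ 2 / (s ^+ 2 - j%:R)).
Proof.
have s_ge1 := law_ge1 law.
elim: j => [|j IHj] jlt.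
  by rewrite big_ord1 subr0 divff ?mulr1 // lt0r_neq0.
have jlt' : j%:R < s ^+ 2 by apply: lt_trans jlt; rewrite ltr_nat.
rewrite big_ord_recr /=; apply: le_trans (lerD (IHj jlt') (lexx _)) _.
have d1 : 0 < s ^+ 2 - j%:R by rewrite subr_gt0.
have d2 : 0 < s ^+ 2 - j.+1%:R by rewrite subr_gt0.
have -> : p j * (s ^+ 2 / (s ^+ 2 - j%:R)) + p j.+1 =
    p j.+1 * ((s ^+ 2 + 1) / (s ^+ 2 - j%:R)).
  have -> : p j * (s ^+ 2 / (s ^+ 2 - j%:R)) = (s ^+ 2 * p j) / (s ^+ 2 - j%:R).
    by rewrite mulrCA mulrA.
  rewrite p_rec -natr1; field; exact: lt0r_neq0.
rewrite (ler_pM2l (p_gt0 _)) ler_pdivrMr // mulrAC ler_pdivlMr //.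
have j0 : 0 <= j%:R :> R by rewrite ler0n.
move: d1 d2; rewrite -natr1; move: (j%:R) j0 => x; nra.
Qed.

(** The geometric bound is used up to a standard deviation below the mean;
    each of the remaining terms is at most [p j]. *)
Lemma p_head j : (j%:R : R) <= s ^+ 2 ->
  \sum_(i < j.+1) p i <= p j * (s + 1 + Num.max 0 (j%:R - (s ^+ 2 - s))).
Proof.
have s_ge1 := law_ge1 law.
have far k : (k%:R : R) <= s ^+ 2 - s -> \sum_(i < k.+1) p i <= p k * s.
  move=> kle; have klt : (k%:R : R) < s ^+ 2 by lra.
  apply: le_trans (p_head_far klt) _; rewrite (ler_pM2l (p_gt0 _)) ler_pdivrMr; last by lra.
  by move: kle; move: (k%:R : R) => x; nra.
elim: j => [|j IHj] jle.
  rewrite big_ord1 -[leLHS]mulr1 (ler_pM2l (p_gt0 _)).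
  have : 0 <= Num.max 0 (0%:R - (s ^+ 2 - s)) by rewrite le_max lexx.
  by move: (Num.max _ _) => x; lra.
have jle' : (j%:R : R) <= s ^+ 2 by apply: le_trans jle; rewrite ler_nat.
have [jfar|jnear] := lerP (j.+1%:R) (s ^+ 2 - s).
  apply: le_trans (far _ jfar) _; rewrite (ler_pM2l (p_gt0 _)).
  have : 0 <= Num.max 0 (j.+1%:R - (s ^+ 2 - s)) by rewrite le_max lexx.
  by move: (Num.max _ _) => x; lra.
have p_incr : p j <= p j.+1.
  rewrite p_next ler_peMl //; first exact: (ltW (p_gt0 _)).
  by rewrite ler_pdivlMr ?ltr0n // mul1r.
have -> : Num.max 0 (j.+1%:R - (s ^+ 2 - s)) = j.+1%:R - (s ^+ 2 - s).
  by apply/max_idPr; rewrite subr_ge0 ltW.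
rewrite big_ord_recr /=.
have j1 : (j.+1%:R : R) = j%:R + 1 by rewrite -natr1.
have [jfar|jnear'] := lerP (j%:R) (s ^+ 2 - s).
  apply: le_trans (lerD (far _ jfar) (lexx _)) _.
  move: (p_gt0 j.+1) p_incr jnear; rewrite j1; move: (p j.+1) (p j) (j%:R : R).
  by move=> a b x; nra.
apply: le_trans (lerD (IHj jle') (lexx _)) _.
have -> : Num.max 0 (j%:R - (s ^+ 2 - s)) = j%:R - (s ^+ 2 - s).
  by apply/max_idPr; rewrite subr_ge0 ltW.
move: (p_gt0 j.+1) p_incr jnear'; rewrite j1; move: (p j.+1) (p j) (j%:R : R).
by move=> a b x; nra.
Qed.

(** From [j] on the ratio of consecutive terms is at most
    [s ^+ 2 / j.+1%:R]. *)
Lemma p_tail_far m j : s ^+ 2 < j.+1%:R ->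
  \sum_(i < m) p (j.+1 + i)%N <= p j * (s ^+ 2 / (j.+1%:R - s ^+ 2)).
Proof.
have s_ge1 := law_ge1 law.
elim: m j => [|m IHm] j jgt.
  by rewrite big_ord0 mulr_ge0 ?divr_ge0 ?subr_ge0 ?(ltW (p_gt0 _)) ?ltW.
have jgt' : s ^+ 2 < j.+2%:R by apply: lt_trans jgt _; rewrite ltr_nat.
rewrite big_ord_recl addn0 (eq_bigr (fun i : 'I_m => p (j.+2 + i)%N)); last first.
  by move=> i _; rewrite /= /bump /= add1n addnS.
apply: le_trans (lerD (lexx _) (IHm _ jgt')) _.
have j1 : (j.+2%:R : R) = j.+1%:R + 1 by rewrite -natr1.
have j0 : (0 : R) < j.+1%:R by rewrite ltr0n.
rewrite p_next j1; rewrite j1 in jgt'; move: jgt jgt' j0 (p_gt0 j).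
move: (j.+1%:R : R) (p j) => x a x1 x2 x0 a0.
have -> : s ^+ 2 / x * a + s ^+ 2 / x * a * (s ^+ 2 / (x + 1 - s ^+ 2)) =
   a * (s ^+ 2 * ((x + 1) / (x * (x + 1 - s ^+ 2)))).
  by field; apply/andP; split; lra.
rewrite ler_pM2l // ler_pM2l // ler_pdivrMr; last by apply: mulr_gt0; lra.
by rewrite ler_pdivlMl; nra.
Qed.

Lemma p_tail m j : s ^+ 2 <= j.+1%:R ->
  \sum_(i < m) p (j.+1 + i)%N <=
  p j * (s + 1 + Num.max 0 (s ^+ 2 + s - j.+1%:R)).
Proof.
have s_ge1 := law_ge1 law.
have far m' k : s ^+ 2 + s <= (k.+1%:R : R) ->
    \sum_(i < m') p (k.+1 + i)%N <= p k * s.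
  move=> kge; have kgt : s ^+ 2 < k.+1%:R by lra.
  apply: le_trans (p_tail_far _ kgt) _; rewrite (ler_pM2l (p_gt0 _)) ler_pdivrMr; last by lra.
  by move: kge; move: (k.+1%:R : R) => x; nra.
elim: m j => [|m IHm] j jge.
  rewrite big_ord0 mulr_ge0 //; first exact: (ltW (p_gt0 _)).
  have : 0 <= Num.max 0 (s ^+ 2 + s - j.+1%:R) by rewrite le_max lexx.
  by move: (Num.max _ _) => x; lra.
have [jfar|jnear] := lerP (s ^+ 2 + s) (j.+1%:R).
  apply: le_trans (far _ _ jfar) _; rewrite (ler_pM2l (p_gt0 _)).
  have : 0 <= Num.max 0 (s ^+ 2 + s - j.+1%:R) by rewrite le_max lexx.
  by move: (Num.max _ _) => x; lra.
have p_decr : p j.+1 <= p j.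
  rewrite p_next (ger_pMl _ (p_gt0 _)) ler_pdivrMr ?ltr0n // mul1r //.
have -> : Num.max 0 (s ^+ 2 + s - j.+1%:R) = s ^+ 2 + s - j.+1%:R.
  by apply/max_idPr; rewrite subr_ge0 ltW.
rewrite big_ord_recl addn0 (eq_bigr (fun i : 'I_m => p (j.+2 + i)%N)); last first.
  by move=> i _; rewrite /= /bump /= add1n addnS.
have j1 : (j.+2%:R : R) = j.+1%:R + 1 by rewrite -natr1.
have [jfar|jnear'] := lerP (s ^+ 2 + s) (j.+2%:R).
  apply: le_trans (lerD (lexx _) (far _ _ jfar)) _.
  move: (p_gt0 j.+1) p_decr jnear; move: (p j.+1) (p j) (j.+1%:R : R).
  by move=> a b x; nra.
have jge' : s ^+ 2 <= j.+2%:R by rewrite j1; lra.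
apply: le_trans (lerD (lexx _) (IHm _ jge')) _.
have -> : Num.max 0 (s ^+ 2 + s - j.+2%:R) = s ^+ 2 + s - j.+2%:R.
  by apply/max_idPr; rewrite subr_ge0 ltW.
move: (p_gt0 j.+1) p_decr jnear'; rewrite j1; move: (p j.+1) (p j) (j.+1%:R : R).
by move=> a b x; nra.
Qed.

(** [p j] dominates either the head or the tail of the distribution up to the
    order of the standard deviation [s]. *)
Lemma head_tail_bound j (F := \sum_(i < j.+1) p i) : F * (1 - F) <= 3 * s * p j.
Proof.
have s_ge1 := law_ge1 law.
have F1 : F <= 1 by apply: p_sum_le1.
have F0 : 0 <= F by apply: sumr_ge0 => i _; apply: (ltW (p_gt0 _)).
have pj := p_gt0 j.
have [jle|jgt] := lerP (j%:R) (s ^+ 2).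
  have := p_head jle; rewrite -/F.
  have: Num.max 0 (j%:R - (s ^+ 2 - s)) <= s.
    by rewrite ge_max; apply/andP; split; lra.
  by move: (Num.max _ _) => x xs le_F; nra.
have jge : s ^+ 2 <= j.+1%:R by apply: ltW; apply: lt_trans jgt _; rewrite ltr_nat.
have: Num.max 0 (s ^+ 2 + s - j.+1%:R) <= s.
  by rewrite ge_max; apply/andP; split; lra.
move=> xs; suff : 1 - F <= p j * (s + 1 + Num.max 0 (s ^+ 2 + s - j.+1%:R)).
  by move: xs; move: (Num.max _ _) => x xs le_F; nra.
rewrite lerBlDl; apply: p_sum_sup => m.
apply: (@le_trans _ _ (\sum_(i < j.+1 + m) p i)).
  rewrite addnC big_split_ord /= lerDl; apply: sumr_ge0 => i _; exact: (ltW (p_gt0 _)).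
by rewrite big_split_ord /= lerD2l; apply: p_tail.
Qed.

Section Solution.
Variables (g : nat -> R) (m : nat).

Definition mean := \sum_(i < m) p i * g i.

(** The solution of the Stein equation of the Poisson law [p]; at 0, where the
    equation leaves it free, it is 0. *)
Definition stein j : R := (\sum_(i < j) p i * (g i - mean)) / (j%:R * p j).

Lemma stein_eq j : s ^+ 2 * stein j.+1 - j%:R * stein j = g j - mean.
Proof.
have s_ge1 := law_ge1 law.
rewrite /stein big_ord_recr /= -p_rec.
set S := \sum_(i < j) _.
have -> : j%:R * (S / (j%:R * p j)) = S / p j.
  case: j @S => [|j] S; first by rewrite /S big_ord0 !mul0r.
  have j0 : (j.+1%:R : R) != 0 by rewrite pnatr_eq0.
  by move: (j.+1%:R : R) j0 (lt0r_neq0 (p_gt0 j.+1)) => x x0 px0; field; rewrite px0.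
have s0 : s != 0 by apply: lt0r_neq0; lra.
by field; rewrite s0 (lt0r_neq0 (p_gt0 _)).
Qed.

(** The numerator of [stein j.+1] is the covariance under [p] of [g] and the
    indicator of [{0, ..., j}], so it is at most [F * (1 - F)] where [F] is
    the probability of this set. *)
Lemma stein_bound j : (forall i, 0 <= g i <= 1) ->
  (forall i, (m <= i)%N -> g i = 0) -> `|stein j| <= 3 / s.
Proof.
have s_ge1 := law_ge1 law.
have s0 : 0 < s by lra.
move=> g01 g_out.
case: j => [|j]; first by rewrite /stein big_ord0 mul0r normr0 divr_ge0 //; lra.
rewrite /stein -p_rec; set F := \sum_(i < j.+1) p i.
have F1 : F <= 1 by apply: p_sum_le1.
have F0 : 0 <= F by apply: sumr_ge0 => i _; apply: (ltW (p_gt0 _)).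
set A := \sum_(i < j.+1) p i * g i.
have A0 : 0 <= A.
  by apply: sumr_ge0 => i _; rewrite mulr_ge0 ?(ltW (p_gt0 _)) //; case/andP: (g01 i).
have AF : A <= F.
  by apply: ler_sum => i _; rewrite (ger_pMr _ (p_gt0 _)); case/andP: (g01 i).
have /andP[T0 T1] : 0 <= mean - A <= 1 - F.
  rewrite /mean; have [mj|jm] := leqP m j.+1.
    have -> : A = \sum_(i < m) p i * g i.
      rewrite /A -(subnKC mj) big_split_ord /= [X in _ + X]big1 ?addr0 // => i _.
      by rewrite g_out ?mulr0 // leq_addr.
    by rewrite subrr lexx subr_ge0.
  rewrite -(subnKC (ltnW jm)) big_split_ord /= -/A addrAC subrr add0r.
  have tail0 i : 0 <= p (j.+1 + i)%N * g (j.+1 + i)%N.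
    by rewrite mulr_ge0 ?(ltW (p_gt0 _)) //; case/andP: (g01 (j.+1 + i)%N).
  rewrite sumr_ge0 //= lerBrDl; apply: le_trans (p_sum_le1 (j.+1 + (m - j.+1))).
  rewrite big_split_ord /= lerD2l; apply: ler_sum => i _.
  by rewrite (ger_pMr _ (p_gt0 _)); case/andP: (g01 (j.+1 + i)%N).
have -> : \sum_(i < j.+1) p i * (g i - mean) = A - F * mean.
  rewrite /A /F big_distrl -sumrB; apply: eq_bigr => i _ /=.
  by rewrite mulrBr.
rewrite normrM normfV (gtr0_norm (mulr_gt0 s2_gt0 (p_gt0 j))).
rewrite ler_pdivrMr; last exact: (mulr_gt0 s2_gt0 (p_gt0 j)).
have -> : 3 / s * (s ^+ 2 * p j) = 3 * s * p j by field; exact: (lt0r_neq0 s0).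
apply: le_trans (head_tail_bound j); rewrite -/F.
rewrite ler_norml; move: (mean) T0 T1 => mu T0 T1.
have -> : A - F * mu = A * (1 - F) - F * (mu - A) by ring.
have h1 : 0 <= A * (1 - F) by rewrite mulr_ge0 // subr_ge0.
have h2 : A * (1 - F) <= F * (1 - F) by rewrite ler_wpM2r // subr_ge0.
have h3 : 0 <= F * (mu - A) by rewrite mulr_ge0.
have h4 : F * (mu - A) <= F * (1 - F) by rewrite ler_wpM2l.
by apply/andP; split; lra.
Qed.

End Solution.
End Stein.

Lemma poisson_pmf_law (R : realType) (lam : R) : (1 <= lam)%R ->
  poisson_law (Num.sqrt lam) (poisson_pmf lam).
Proof.
move=> lam1; have lam0 : (0 < lam)%R by apply: lt_le_trans lam1.
have pmfE i : poisson_pmf lam i = (exp_coeff lam i * expR (- lam))%R.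
  by rewrite /poisson_pmf lam0.
have sumE m : (\sum_(i < m) poisson_pmf lam i =
    series (exp_coeff lam) m * expR (- lam))%R.
  rewrite /series /= big_mkord big_distrl /=.
  by apply: eq_bigr => i _; rewrite pmfE.
split.
- by rewrite -[leLHS]sqrtr1 ler_sqrt // ltW.
- move=> i; rewrite pmfE mulr_gt0 ?expR_gt0 //.
  by rewrite divr_gt0 ?exprn_gt0 // ltr0n fact_gt0.
- move=> i; rewrite sqr_sqrtr ?ltW // !pmfE !mulrA; congr (_ * _)%R.
  rewrite /exp_coeff /= factS natrM exprS.
  by field; rewrite pnatr_eq0 -lt0n fact_gt0 addrC natr1 pnatr_eq0.
- move=> m; rewrite sumE expRN ler_pdivrMr ?expR_gt0 // mul1r.
  rewrite -[expR lam]/(limn (series (exp_coeff lam))).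
  apply: nondecreasing_cvgn_le; last exact: is_cvg_series_exp_coeff.
  apply/nondecreasing_seqP => i; rewrite /series /= big_nat_recr //= lerDl.
  by rewrite /exp_coeff /= divr_ge0 ?exprn_ge0 ?ler0n // ltW.
- move=> b le_b; have : (expR lam <= b * expR lam)%R.
    rewrite -[leLHS]/(limn (series (exp_coeff lam))); apply: limr_le; first exact: is_cvg_series_exp_coeff.
    apply: nearW => m; rewrite -ler_pdivrMr ?expR_gt0 // -expRN -sumE.
    exact: le_b.
  by rewrite -{1}[expR lam]mul1r ler_pM2r ?expR_gt0.
Qed.

(** * Detailed balance *)

Section Exchange.
Variables (n d r : nat).
Implicit Types (g h : sgraph n) (c : seq 'I_n) (x y : 'I_n).

Definition creations k h : nat :=
  \sum_x sumseq k (fun c => \sum_y good_path r h x c y).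

(** The good switches that create a [k]-cycle, seen from the graph [g] to which
    they lead. *)
Definition destructions k g : nat :=
  \sum_x sumseq k (fun c => \sum_y
    (switchable g x y (head x c) (last y c) &&
     good_path r (switch g x y (head x c) (last y c)) x c y)).

Lemma good_path_cycle g x c y : 0 < size c ->
  switchable g x y (head x c) (last y c) ->
  good_path r (switch g x y (head x c) (last y c)) x c y ->
  simple_cycle g c && adjacent g x y.
Proof.
case: c => [|b c] // _; rewrite [head _ _]/= [last _ _]/=.
set e := last b c => sw /and3P[/andP[uw pw] _ _].
have /and5P[_ xy be _ _] := sw; rewrite xy andbT.
have /andP[xNc /andP[yNc uc]] :
    (x \notin b :: c) && ((y \notin b :: c) && uniq (b :: c)).
  rewrite -rcons_uniq; move: uw; rewrite cons_uniq => /andP[+ ->].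
  by rewrite andbT mem_rcons inE negb_or => /andP[].
have pc : path (adjacent (switch g x y b e)) b c.
  by move: pw; rewrite /= rcons_path => /and3P[].
have cyc : cycle (adjacent g) (b :: c) = path (adjacent g) b (rcons c b) by [].
rewrite /simple_cycle uc cyc rcons_path.
rewrite -/e adjacentC be andbT.
apply: (@sub_in_path _ (mem (b :: c)) _ _ _ _ _ _ pc) => [u v uc' vc|]; last exact/allP.
rewrite (adjacent_switch _ _ sw) /same_pair.
have ne z z' : z \in b :: c -> z' \notin b :: c -> (z == z') = false.
  by move=> zc z'c; apply: contraNF z'c => /eqP <-.
rewrite !(ne u x) // !(ne u y) // !(ne v x) // !(ne v y) // !andbF /= !orbF.
by case/andP.
Qed.

(** Such a switch is determined by a rooted [k]-cycle and an oriented edge. *)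
Lemma destructions_le k g : g \in regular_graphs n d -> 3 <= k ->
  destructions k g <= n * d * (2 * k * cycle_count k g).
Proof.
move=> gR k3; rewrite -count_simple_cycleE // mulnC -sumseqMr /destructions.
rewrite -sumseq_big; apply: leq_sumseq => c sz_c.
rewrite -(sum_adjacent gR) big_distrr /=; apply: leq_sum => x _.
rewrite big_distrr /=; apply: leq_sum => y _.
case: (boolP (switchable _ _ _ _ _)) => // sw.
case: (boolP (good_path _ _ _ _ _)) => // gp.
have c0 : 0 < size c by rewrite sz_c (leq_trans _ k3).
by have /andP[-> ->] := good_path_cycle c0 sw gp.
Qed.

Lemma creations_le k h : h \in regular_graphs n d ->
  creations k h <= n * d * d.-1 ^ k.
Proof.
move=> hR; apply: leq_trans (count_simple_path hR k); rewrite sumseq_ends.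
apply: leq_sum => x _; apply: leq_sumseq => c _; apply: leq_sum => y _.
by rewrite /good_path; case: simple_path => //=; case: (_ && _).
Qed.

Local Open Scope ring_scope.
Variable K : realFieldType.

(** Detailed balance: a good switch leads from a graph where it creates a cycle
    to a graph where it is undone. *)
Lemma switch_exchange k (F0 F1 : sgraph n -> K) :
  (forall h x c y, size c = k -> good_path r h x c y ->
     F1 h = F0 (switch h x (head x c) y (last y c))) ->
  \sum_(h in regular_graphs n d) (creations k h)%:R * F1 h =
  \sum_(g in regular_graphs n d) (destructions k g)%:R * F0 g.
Proof.
move=> F10.
have sum_xyc (P : sgraph n -> 'I_n -> seq 'I_n -> 'I_n -> bool) (F : sgraph n -> K) :
    \sum_(h in regular_graphs n d)
      (\sum_x sumseq k (fun c => \sum_y P h x c y))%N%:R * F h =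
    \sum_x \sum_(c : k.-tuple 'I_n) \sum_y
      \sum_(h in regular_graphs n d) (P h x c y)%:R * F h.
  under eq_bigr => h _.
    rewrite natr_sum big_distrl /=; under eq_bigr => x _.
      rewrite sumseq_tuple natr_sum big_distrl /=; under eq_bigr => c _.
        rewrite natr_sum big_distrl /=; over.
      over.
    over.
  rewrite exchange_big /=; apply: eq_bigr => x _.
  rewrite exchange_big /=; apply: eq_bigr => c _.
  by rewrite exchange_big.
rewrite [LHS]sum_xyc [RHS]sum_xyc.
apply: eq_bigr => x _; apply: eq_bigr => c _; apply: eq_bigr => y _.
set b := head x c; set e := last y c.
transitivity (\sum_(h in regular_graphs n d | switchable h x b y e)
   (good_path r h x c y)%:R * F0 (switch h x b y e)).
  rewrite big_mkcondr /=; apply: eq_bigr => h _.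
  have [gp|] := boolP (good_path r h x c y); last by rewrite !mul0r; case: switchable.
  by have /and3P[_ -> _] := gp; rewrite (F10 h x c y) // size_tuple.
rewrite (sum_switch d x b y e (fun h g => (good_path r h x c y)%:R * F0 g)).
rewrite big_mkcondr /=; apply: eq_bigr => g _.
by case: switchable; rewrite //= mul0r.
Qed.

Hypotheses (d3 : (3 <= d)%N) (nbig : (8 * r + 4 * d <= n)%N).

(** By [switch_exchange] the good switches cancel.  What remains are the bad
    switches on either side, of which there are few in total since the sums
    of [creations] and of [destructions] agree. *)
Lemma switch_error k (F0 F1 : sgraph n -> K) (M : K) : (3 <= k <= r)%N ->
  (forall h x c y, size c = k -> good_path r h x c y ->
     F1 h = F0 (switch h x (head x c) y (last y c))) ->
  (forall h, `|F0 h| <= M) -> (forall h, `|F1 h| <= M) ->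
  `|\sum_(h in regular_graphs n d) ((n * d * d.-1 ^ k)%:R * F1 h -
       (n * d * (2 * k * cycle_count k h))%:R * F0 h)| <=
  (92 * k * #|regular_graphs n d| * d.-1 ^ (k + r))%:R * M.
Proof.
move=> k3r F10 F0M F1M; have /andP[k3 kr] := k3r.
set S := regular_graphs n d; set D := (n * d * d.-1 ^ k)%N.
have -> : \sum_(h in S) (D%:R * F1 h - (n * d * (2 * k * cycle_count k h))%:R * F0 h)
  = \sum_(h in S) ((D - creations k h)%:R * F1 h -
      (n * d * (2 * k * cycle_count k h) - destructions k h)%:R * F0 h).
  rewrite !sumrB.
  under [X in _ = X - _]eq_bigr => h hS do
    rewrite (natrB _ (creations_le k hS)) mulrBl.
  under [X in _ = _ - X]eq_bigr => h hS do
    rewrite (natrB _ (destructions_le hS k3)) mulrBl.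
  by rewrite !sumrB (switch_exchange F10) opprB addrA subrK.
apply: le_trans (ler_norm_sum _ _ _) _.
apply: (@le_trans _ _ (\sum_(h in S) (D - creations k h +
      (n * d * (2 * k * cycle_count k h) - destructions k h))%:R * M)).
  apply: ler_sum => h _; apply: le_trans (ler_normB _ _) _.
  by rewrite natrD mulrDl !normrM !normr_nat lerD // ler_wpM2l.
have M0 : 0 <= M by apply: le_trans (F0M point).
rewrite -big_distrl /= -natr_sum ler_wpM2r // ler_nat.
have eq_cd : (\sum_(h in S) destructions k h = good_total n d r k)%N.
  rewrite -[RHS]/(\sum_(h in S) creations k h)%N.
  apply/eqP; rewrite -(eqr_nat K) !natr_sum; apply/eqP.
  have := @switch_exchange k (fun=> 1) (fun=> 1) (fun _ _ _ _ _ _ => erefl).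
  by rewrite -!big_distrl /= !mulr1 => ->.
rewrite big_split /= sumnB => [|h]; last exact: creations_le.
rewrite sumnB => [|h hS]; last exact: destructions_le.
rewrite eq_cd sum_nat_const -big_distrr /=.
have := good_total_lower d3 nbig k3r.
have := cycle_total_upper d3 nbig k3r.
rewrite -/S -/D -[(\sum_(h in S) creations k h)%N]/(good_total n d r k).
move: (good_total n d r k) (#|S| * D)%N (n * d * _)%N => A B C.
rewrite -!(mulnA _ #|S|) -!(mulnA _ k).
move: (k * (#|S| * d.-1 ^ (k + r)))%N => E; clear; lia.
Qed.

End Exchange.

(** * Replacing the cycle counts by Poisson variables one at a time *)

Section Telescoping.
Local Open Scope ring_scope.
Variables (R : realFieldType) (p : nat -> nat -> R) (s : nat -> R) (m r : nat).
Variable f : (nat -> nat) -> R.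
Hypothesis law : forall k, poisson_law (s k.+3) (p k.+3).
Hypothesis f01 : forall w, 0 <= f w <= 1.
Hypothesis f_out : forall w k, (3 <= k <= r)%N -> (m <= w k)%N -> f w = 0.
Hypothesis f_ext : forall w w', (forall k, (3 <= k <= r)%N -> w k = w' k) ->
  f w = f w'.

Definition update (w : nat -> nat) k j : nat -> nat :=
  fun l => if l == k then j else w l.

(** The mean of [f] after the coordinates [3, ..., i + 2] have been replaced by
    independent variables with the laws [p k], truncated below [m]. *)
Fixpoint average i w : R :=
  if i is i'.+1 then \sum_(j < m) p i'.+3 j * average i' (update w i'.+3 j)
  else f w.

Lemma average_01 i w : 0 <= average i w <= 1.
Proof.
elim: i w => [|i IHi] w /=; first exact: f01.
have p0 j : 0 <= p i.+3 j by apply: ltW; apply: law_gt0 (law i) j.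
apply/andP; split.
  by apply: sumr_ge0 => j _; rewrite mulr_ge0 //; case/andP: (IHi (update w i.+3 j)).
apply: le_trans (law_sum_le1 (law i) m); apply: ler_sum => j _.
by rewrite ler_piMr //; case/andP: (IHi (update w i.+3 j)).
Qed.

Lemma average_out i w k : (i.+3 <= k <= r)%N -> (m <= w k)%N -> average i w = 0.
Proof.
elim: i w => [|i IHi] w kr wk /=; first exact: f_out kr wk.
rewrite big1 // => j _; rewrite IHi ?mulr0 //.
  by case/andP: kr => /ltnW -> ->.
by rewrite /update; case: eqP => // ek; move: kr; rewrite ek ltnn.
Qed.

Lemma average_ext i w w' : (forall k, (i.+3 <= k <= r)%N -> w k = w' k) ->
  average i w = average i w'.
Proof.
elim: i w w' => [|i IHi] w w' eqw /=; first exact: f_ext.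
apply: eq_bigr => j _; congr (_ * _); apply: IHi => k /andP[ik kr].
rewrite /update; case: eqP => // /eqP nek; apply: eqw.
by rewrite kr andbT ltn_neqAle eq_sym nek.
Qed.

(** The function of the coordinate [i.+3] alone to which the Stein equation is
    applied. *)
Definition coordinate i w j := average i (update w i.+3 j).

Lemma average_step i w : (i.+3 <= r)%N ->
  average i w - average i.+1 w =
  s i.+3 ^+ 2 * stein (p i.+3) (coordinate i w) m (w i.+3).+1 -
  (w i.+3)%:R * stein (p i.+3) (coordinate i w) m (w i.+3).
Proof.
move=> ir; rewrite (stein_eq (law i)); congr (_ - _).
by apply: average_ext => k _; rewrite /update; case: eqP => // ->.
Qed.

Lemma coordinate_stein_bound i w j : (i.+3 <= r)%N ->
  `|stein (p i.+3) (coordinate i w) m j| <= 3 / s i.+3.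
Proof.
move=> ir; apply: (stein_bound (law i)) => [l|l ml]; first exact: average_01.
apply: (@average_out i _ i.+3); first by rewrite leqnn.
by rewrite /update eqxx.
Qed.

Section Graphs.
Variables (n d : nat).
Hypotheses (d3 : (3 <= d)%N) (nbig : (8 * r + 4 * d <= n)%N).
Hypothesis s_sqr : forall k, s k.+3 ^+ 2 = d.-1%:R ^+ k.+3 / (2 * k.+3%:R).
Let S := regular_graphs n d.
Let counts (h : sgraph n) := fun k => cycle_count k h.

Lemma good_path_count h x (c : seq 'I_n) y j : good_path r h x c y ->
  (3 <= j <= r)%N ->
  cycle_count j (switch h x (head x c) y (last y c)) =
  (cycle_count j h + (j == size c))%N.
Proof.
case/and3P=> _ _ /forallP gp /andP[j3 jr]; have jr' : (j < r.+1)%N by [].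
by have /implyP /(_ j3) /eqP := gp (Ordinal jr').
Qed.

(** A good switch changes [counts] in the coordinate [k] only, as far as
    [average i] can see, and there by 1.  Hence it matches the two terms of
    the Stein equation. *)
Lemma coordinate_error i : (i.+3 <= r)%N ->
  `|\sum_(h in S) (average i (counts h) - average i.+1 (counts h))| <=
  138 * #|S|%:R * d.-1%:R ^+ (i.+3 + r) / (s i.+3 * (n * d)%:R).
Proof.
move=> ir; set k := i.+3; set q := d.-1.
pose st w := stein (p k) (coordinate i w) m.
pose F0 h := st (counts h) (counts h k).
pose F1 h := st (counts h) (counts h k).+1.
have n0 : (0 < n)%N by move: nbig d3; clear; lia.
have D0 : 0 < (2 * k * (n * d))%N%:R :> R.
  by rewrite ltr0n !muln_gt0 n0 /=; move: d3; clear; lia.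
have F10 h x c y : size c = k -> good_path r h x c y ->
    F1 h = F0 (switch h x (head x c) y (last y c)).
  move=> sz_c gp; rewrite /F0 /F1 /st /counts.
  rewrite (good_path_count gp (_ : (3 <= k <= r)%N)) ?ir // sz_c eqxx addn1.
  congr (stein _ _ _ _); apply/funext => j; apply: average_ext => l /andP[il lr].
  rewrite /update; case: eqP => // /eqP nelk; rewrite (good_path_count gp).
    by rewrite sz_c (negPf nelk) addn0.
  by rewrite lr andbT; apply: leq_trans il.
have := @switch_error n d r R d3 nbig k F0 F1 (3 / s k) _ F10.
rewrite ir /= => /(_ isT (fun h => coordinate_stein_bound _ _ ir)
                      (fun h => coordinate_stein_bound _ _ ir)) err.
have -> : \sum_(h in S) (average i (counts h) - average i.+1 (counts h)) =
   (2 * k * (n * d))%N%:R^-1 *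
   \sum_(h in S) ((n * d * q ^ k)%:R * F1 h -
       (n * d * (2 * k * cycle_count k h))%:R * F0 h).
  rewrite big_distrr /=; apply: eq_bigr => h _; rewrite (average_step _ ir).
  rewrite -/k -/(st (counts h)) -/(F1 h) -/(F0 h) s_sqr -/k -/q.
  rewrite (natrM _ _ (q ^ k)) natrX !natrM; move: (F0 h) (F1 h) => a b.
  have n0' : n%:R != 0 :> R by rewrite pnatr_eq0 -lt0n.
  have d0' : d%:R != 0 :> R by rewrite pnatr_eq0 -lt0n; move: d3; clear; lia.
  have k0' : k%:R != 0 :> R by rewrite pnatr_eq0.
  rewrite /counts; move: (k%:R : R) (n%:R : R) (d%:R : R) k0' n0' d0' => k' n' d' *.
  by field; apply/and3P.
rewrite normrM gtr0_norm ?invr_gt0 // mulrC ler_pdivrMr //.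
apply: le_trans err _.
have s0 : s k != 0 by apply: lt0r_neq0; apply: lt_le_trans (law_ge1 (law i)).
have e92 : (92 * k * #|S| * q ^ (k + r))%:R * (3 / s k) =
  138 * #|S|%:R * q%:R ^+ (k + r) / (s k * (n * d)%:R) * (2 * k * (n * d))%:R :> R.
  rewrite (natrM _ _ (q ^ (k + r))) natrX !natrM.
  have n0' : n%:R != 0 :> R by rewrite pnatr_eq0 -lt0n.
  have d0' : d%:R != 0 :> R by rewrite pnatr_eq0 -lt0n; move: d3; clear; lia.
  by field; rewrite s0 n0' d0'.
by rewrite e92.
Qed.

Lemma counts_error w0 :
  `|\sum_(h in S) (f (counts h) - average (r - 2) w0)| <=
  \sum_(i < r - 2)
     138 * #|S|%:R * d.-1%:R ^+ (i.+3 + r) / (s i.+3 * (n * d)%:R).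
Proof.
have tel M : (M <= r - 2)%N ->
  `|\sum_(h in S) (f (counts h) - average M (counts h))| <= \sum_(i < M)
     138 * #|S|%:R * d.-1%:R ^+ (i.+3 + r) / (s i.+3 * (n * d)%:R).
  elim: M => [|M IHM] Mr.
    by rewrite big_ord0 big1 ?normr0 // => h _; rewrite subrr.
  rewrite big_ord_recr /=; apply: le_trans (lerD (IHM (ltnW Mr)) (coordinate_error _)).
    apply: le_trans (ler_normD _ _); rewrite -big_split /= le_eqVlt.
    apply/orP; left; apply/eqP; congr (`|_|); apply: eq_bigr => h _.
    by rewrite addrA subrK.
  by move: Mr; clear; lia.
rewrite (eq_bigr (fun h => f (counts h) - average (r - 2) (counts h))) => [|h _].
  exact: tel.
congr (_ - _); apply: average_ext => k; clear; lia.
Qed.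

End Graphs.
End Telescoping.

(** * Laws of the random graph and of the Poisson variables *)

Section Laws.
Local Open Scope classical_set_scope.
Local Open Scope ring_scope.
Variable R : realType.

Lemma uniform_event n d (dO : measure_display) (Omega : measurableType dO)
    (P : probability Omega R) (G : {RV P >-> sgraph n}) (B : pred (sgraph n)) :
  uniform_regular_graph d G ->
  measurable [set w | B (G w)] /\
  P [set w | B (G w)] =
    (#|regular_graphs n d|%:R^-1 *
       \sum_(g in regular_graphs n d) (B g)%:R)%:E.
Proof.
move=> unif.
have mG g : measurable (G @^-1` [set g]).
  by rewrite -[_ @^-1` _]setTI; apply: measurable_funP.
have eqB : [set w | B (G w)] =
    \bigcup_(g in [set` enum B]) (G @^-1` [set g]).
  apply/seteqP; split=> [w Bw|w [g /=]].
    by exists (G w) => //=; rewrite mem_enum.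
  by rewrite mem_enum => Bg eqg; rewrite -eqg in Bg.
have finB : finite_set [set` enum B] by exact: finite_seq.
split; first by rewrite eqB; apply: fin_bigcup_measurable.
rewrite eqB measure_fin_bigcup //; last first.
  by move=> g g' _ _ [w [/= <- <-]].
rewrite -fsbig_seq ?enum_uniq // big_enum /= big_distrr /=.
rewrite -sumEFin [RHS]big_mkcond [LHS]big_mkcond /=.
apply: eq_bigr => g _; rewrite unif unfold_in.
by case: ifP => // Bg; case: ifP => // gR; rewrite ?Bg ?mulr1 ?mulr0.
Qed.

Section Independent.
Variables (dO : measure_display) (Omega : measurableType dO).
Variables (P : probability Omega R) (Z : nat -> {RV P >-> nat}).
Variables (p : nat -> nat -> R) (m r : nat) (f : (nat -> nat) -> R).
Hypothesis indep : mutually_independent [set k : nat | (3 <= k)%N] Z.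
Hypothesis Zp : forall k j, (3 <= k)%N -> P (Z k @^-1` [set j]) = (p k j)%:E.
Hypothesis r3 : (3 <= r)%N.
Hypothesis f01 : forall w, f w = 0 \/ f w = 1.
Hypothesis f_ext : forall w w', (forall k, (3 <= k <= r)%N -> w k = w' k) ->
  f w = f w'.

Let J : {fset nat} := [fset k in iota 3 (r - 2)]%fset.

Let memJ k : (k \in J) = (3 <= k <= r)%N.
Proof. by rewrite !inE mem_iota; move: r3; clear; lia. Qed.

(** Built along [average], so that its probability can be computed by the same
    recursion: [f] is 1 at [Z], which agrees with [w] from the coordinate [i.+3]
    on and is below [m] before. *)
Fixpoint event i w : set Omega :=
  if i is i'.+1 then
    \big[setU/set0]_(j < m) event i' (update w i'.+3 j)
  else if f w == 1 then \bigcap_(k in [set` J]) (Z k @^-1` [set w k]) else set0.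

Lemma measurable_event i w : measurable (event i w).
Proof.
elim: i w => [|i IHi] w /=; last by apply: bigsetU_measurable => j _.
case: ifP => _ //; apply: fin_bigcap_measurable => // k _.
by rewrite -[_ @^-1` _]setTI; apply: measurable_funP.
Qed.

Lemma event_coordinates i w (o : Omega) k : event i w o -> (i.+3 <= k <= r)%N ->
  Z k o = w k.
Proof.
elim: i w => [|i IHi] w /=.
  case: ifP => // _ /(_ k) ow k3r; apply: ow; rewrite /= memJ //.
rewrite -(bigcup_mkord _ (fun j => event i (update w i.+3 j))) => -[j /= jm ow] /andP[ik kr].
have := IHi _ ow; rewrite /update => ->; last by rewrite kr (ltnW ik).
by case: eqP => // ek; move: ik; rewrite ek ltnn.
Qed.

Lemma event_f i w (o : Omega) : event i w o -> f (fun k => Z k o) = 1.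
Proof.
elim: i w => [|i IHi] w /=.
  case: ifP => // /eqP <- ow; apply: f_ext => k k3r.
  by apply: ow; rewrite /= memJ.
by rewrite -(bigcup_mkord _ (fun j => event i (update w i.+3 j))) => -[j /= jm]; apply: IHi.
Qed.

Lemma prob_event i w : (i.+3 <= r.+1)%N ->
  P (event i w) = (average p m f i w * \prod_(i.+3 <= k < r.+1) p k (w k))%:E.
Proof.
elim: i w => [|i IHi] w ir /=.
  case: eqP => [->|nf]; last first.
    by have [->|//] := f01 w; rewrite measure0 mul0r.
  rewrite (@indep J (fun k => [set w k])) //; last by move=> k /=; rewrite memJ => /andP[].
  rewrite mul1r -prodEFin; rewrite (perm_big (iota 3 (r - 2))) /=; last first.
    apply: uniq_perm; rewrite ?fset_uniq ?iota_uniq // => k.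
    by rewrite memJ mem_iota; move: r3; clear; lia.
  have -> : iota 3 (r - 2) = index_iota 3 r.+1.
    by rewrite /index_iota; congr iota; move: r3; clear; lia.
  rewrite big_nat_cond [RHS]big_nat_cond; apply: eq_bigr => k /andP[/andP[k3 _] _].
  exact: Zp.
rewrite (@measure_bigsetU _ _ _ _ (fun j => event i (update w i.+3 j))).
- rewrite big_distrl /= -sumEFin; apply: eq_bigr => j _.
  rewrite IHi; last exact: ltnW.
  have -> : \prod_(i.+3 <= k < r.+1) p k (update w i.+3 j k) =
      p i.+3 j * \prod_(i.+4 <= k < r.+1) p k (w k).
    rewrite big_ltn //; congr (_ * _); first by rewrite /update eqxx.
    apply: eq_big_nat => k /andP[ik _].
    by rewrite /update; case: eqP => // ek; move: ik; rewrite ek ltnn.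
  by rewrite mulrCA mulrA.
- by move=> j; apply: measurable_event.
- move=> j j' _ _ [t [/= oj oj']].
  have k3r : (i.+3 <= i.+3 <= r)%N by rewrite leqnn -ltnS.
  have := event_coordinates oj k3r.
  by rewrite (event_coordinates oj' k3r) /update eqxx => ->.
Qed.

Lemma average_le_prob w0 (B : set Omega) : measurable B ->
  (forall o, f (fun k => Z k o) = 1 -> B o) ->
  ((average p m f (r - 2) w0)%:E <= P B)%E.
Proof.
move=> mB fB; have er : (r - 2).+3 = r.+1 by move: r3; clear; lia.
have := @prob_event (r - 2) w0; rewrite er leqnn big_geq // mulr1 => <- //.
apply: le_measure; rewrite ?inE //; first exact: measurable_event.
by move=> o /event_f; apply: fB.
Qed.

End Independent.
End Laws.

(** * Numerical bounds *)

Section Numerics.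
Local Open Scope ring_scope.
Variables (R : realType) (n r d : nat).
Hypotheses (n0 : (0 < n)%N) (r3 : (3 <= r)%N) (d3 : (3 <= d)%N).

Let q : R := d%:R - 1.
Let t : R := Num.sqrt q.

Let qE : q = d.-1%:R.
Proof. by rewrite /q -[in LHS](ltn_predK d3) -natr1 addrK. Qed.

Let q2 : 2 <= q.
Proof. by rewrite qE ler_nat; move: d3; clear; lia. Qed.

Let q0 : 0 < q. Proof. by apply: lt_le_trans q2. Qed.

Let t2 : t ^+ 2 = q. Proof. by rewrite sqr_sqrtr // ltW. Qed.

Let t43 : 4 / 3 <= t.
Proof.
rewrite -(@ler_pXn2r _ 2) ?nnegrE //; last exact: sqrtr_ge0.
by rewrite t2; apply: le_trans q2; lra.
Qed.

Let t0 : 0 < t. Proof. by apply: lt_le_trans t43; lra. Qed.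

Definition rate k : R := q ^+ k / (2 * k%:R).

Lemma rate_ge1 k : 1 <= rate k.+3.
Proof.
rewrite /rate ler_pdivlMr; last by rewrite mulr_gt0 ?ltr0n.
rewrite mul1r qE -natrX -natrM ler_nat.
apply: (@leq_trans (2 ^ k.+3)); first by rewrite expnS leq_mul2l /= ltn_expl.
by rewrite leq_exp2r //; move: d3; clear; lia.
Qed.

Lemma powR_exponent :
  q `^ (3 * r%:R / 2 - 1) = q ^+ (r - 1) * t ^+ r.
Proof.
have -> : 3 * r%:R / 2 - 1 = (r - 1)%N%:R + 2^-1 * r%:R :> R.
  by rewrite natrB ?(leq_trans _ r3) //; field.
rewrite powRD; last by apply/implyP => _; rewrite gt_eqF.
by rewrite powRrM powR12_sqrt ?(ltW q0) // !powR_mulrn ?(ltW q0) ?(ltW t0).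
Qed.

Lemma sum_powers m : \sum_(i < m) t ^+ i.+3 <= 4 * t ^+ m.+2.
Proof.
elim: m => [|m IHm]; first by rewrite big_ord0 mulr_ge0 // exprn_ge0 // ltW.
rewrite big_ord_recr /=; apply: le_trans (lerD IHm (lexx _)) _.
rewrite !(exprS _ m.+2); have : 0 <= t ^+ m.+2 by rewrite exprn_ge0 // ltW.
by move: (t ^+ m.+2) t43; move: t => a x a43 x0; nra.
Qed.

(** The Stein factor [1 / Num.sqrt (rate k)] is of order [Num.sqrt k / t ^+ k],
    so the terms grow geometrically and the last one dominates. *)
Lemma error_sum :
  \sum_(i < r - 2) 138 * q ^+ (i.+3 + r) / (Num.sqrt (rate i.+3) * (n * d)%:R)
  <= 1000 * Num.sqrt r%:R * q `^ (3 * r%:R / 2 - 1) / n%:R.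
Proof.
rewrite powR_exponent.
have nR : 0 < n%:R :> R by rewrite ltr0n.
have dR : 0 < d%:R :> R by rewrite ltr0n (leq_trans _ d3).
have q_le_d : q <= d%:R by rewrite /q lerBlDr lerDl.
have sqrt2 : Num.sqrt 2 <= 3 / 2 :> R.
  rewrite -(@ler_pXn2r _ 2) ?nnegrE ?sqrtr_ge0 //.
  by rewrite sqr_sqrtr //; lra.
pose rr : R := Num.sqrt r%:R; rewrite -/rr; have rr0 : 0 <= rr by apply: sqrtr_ge0.
apply: (@le_trans _ _ (\sum_(i < r - 2)
    (207 * rr * q ^+ (r - 1) / n%:R) * t ^+ i.+3)); last first.
  rewrite -big_distrr /=.
  have c0 : 0 <= 207 * rr * q ^+ (r - 1) / n%:R.
    by rewrite divr_ge0 ?(ltW nR) // !mulr_ge0 // exprn_ge0 // ltW.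
  apply: le_trans (ler_wpM2l c0 (sum_powers _)) _.
  have -> : (r - 2).+2 = r by move: r3; clear; lia.
  rewrite [leRHS]mulrAC [leLHS]mulrCA mulrA; rewrite !mulrA.
  have x0 : 0 <= rr * q ^+ (r - 1) * t ^+ r / n%:R.
    by rewrite divr_ge0 ?(ltW nR) // !mulr_ge0 // exprn_ge0 // ltW.
  rewrite [leLHS](_ : _ = 828 * (rr * q ^+ (r - 1) * t ^+ r / n%:R)); last first.
    by field; exact: lt0r_neq0.
  rewrite [leRHS](_ : _ = 1000 * (rr * q ^+ (r - 1) * t ^+ r / n%:R)); last first.
    by field; exact: lt0r_neq0.
  by rewrite ler_wpM2r //; lra.
apply: ler_sum => i _; set k := i.+3.
have kr : (k <= r)%N by rewrite /k; have := ltn_ord i; clear; lia.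
have k0 : 0 < (2 * k%:R : R) by rewrite mulr_gt0 // ltr0n.
have -> : Num.sqrt (rate k) = t ^+ k / Num.sqrt (2 * k%:R).
  rewrite /rate [LHS]sqrtrM ?exprn_ge0 ?(ltW q0) // sqrtrV ?(ltW k0) //.
  by rewrite -{1}t2 -exprM mulnC exprM sqrtr_sqr ger0_norm // exprn_ge0 // ltW.
have sk : Num.sqrt (2 * k%:R) <= 3 / 2 * rr.
  by rewrite sqrtrM // ler_pM ?sqrtr_ge0 // /rr ler_sqrt ?ler_nat.
have sk0 : 0 < Num.sqrt (2 * k%:R : R) by rewrite sqrtr_gt0.
have tk0 : 0 < t ^+ k by rewrite exprn_gt0.
have qk : q ^+ (k + r) = t ^+ k * t ^+ k * (q * q ^+ (r - 1)).
  have -> : q * q ^+ (r - 1) = q ^+ r.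
    by rewrite -exprS; congr (_ ^+ _); move: r3; clear; lia.
  by rewrite (exprD q) -(exprD t) -{1}t2 -exprM addnn mul2n.
have Q0 : 0 < q ^+ (r - 1) by rewrite exprn_gt0.
rewrite qk natrM; move: (q ^+ (r - 1)) Q0 (t ^+ k) tk0 (Num.sqrt (2 * k%:R)) sk0 sk.
move=> Q Q0 T T0 s s0 sk.
have -> : 138 * (T * T * (q * Q)) / (T / s * (n%:R * d%:R)) =
   138 * s * (q / d%:R) * (Q / n%:R * T).
  by field; rewrite !lt0r_neq0.
have -> : 207 * rr * Q / n%:R * T = 207 * rr * (Q / n%:R * T).
  by field; rewrite lt0r_neq0.
apply: ler_wpM2r; first by rewrite mulr_ge0 ?divr_ge0 ?(ltW nR) ?(ltW Q0) ?(ltW T0).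
have qd1 : q / d%:R <= 1 by rewrite ler_pdivrMr // mul1r.
apply: (@le_trans _ _ (138 * s)); first by rewrite ler_piMr ?mulr_ge0 ?(ltW s0).
by lra.
Qed.

(** When [n] is too small for the counting to apply, the bound is vacuous. *)
Lemma error_trivial : (n < 8 * r + 4 * d)%N ->
  1 <= 1000 * Num.sqrt r%:R * q `^ (3 * r%:R / 2 - 1) / n%:R.
Proof.
move=> small; rewrite powR_exponent ler_pdivlMr ?ltr0n // mul1r.
have rr1 : 1 <= Num.sqrt r%:R :> R.
  by rewrite -[leLHS]sqrtr1 ler_sqrt // ler1n; apply: leq_trans r3.
have t1 : 1 <= t ^+ r.
  by apply: exprn_ege1; apply: le_trans t43; lra.
have nQ : n%:R <= 1000 * q ^+ (r - 1).
  rewrite qE -natrX -natrM ler_nat; apply: leq_trans (ltnW small) _.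
  have rQ : (r <= d.-1 ^ (r - 1))%N.
    apply: (@leq_trans (2 ^ (r - 1))).
      by have := ltn_expl (r - 1) (ltnSn 1); move: r3; clear; lia.
    by rewrite leq_exp2r; [move: d3; clear; lia | move: r3; clear; lia].
  have dQ : (d.-1 <= d.-1 ^ (r - 1))%N.
    rewrite -[X in (X <= _)%N]expn1 leq_pexp2l //; first by move: d3; clear; lia.
    by move: r3; clear; lia.
  by move: rQ dQ d3; move: (d.-1 ^ (r - 1))%N => Q; clear; lia.
have Q0 : 0 <= q ^+ (r - 1) by rewrite exprn_ge0 // ltW.
have rQ0 : 0 <= Num.sqrt r%:R * q ^+ (r - 1) by rewrite mulr_ge0 // sqrtr_ge0.
apply: (le_trans nQ).
rewrite -[leRHS]mulrA.
apply: ler_wpM2l; first by rewrite ler0n.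
apply: le_trans (ler_peMl Q0 rr1) _.
by rewrite mulrA; apply: ler_peMr rQ0 t1.
Qed.

End Numerics.

(** * The total variation bound *)

Local Open Scope classical_set_scope.
Local Open Scope ring_scope.

(** One-sided form of the theorem; its application to complements gives the
    other side.  The Poisson variables are only compared on a box that contains
    all possible cycle counts, so that every mean is a finite sum. *)
Lemma cycle_counts_poisson_le (R : realType) n r d (dO dO' : measure_display)
    (Omega : measurableType dO) (P : probability Omega R)
    (G : {RV P >-> sgraph n}) (Omega' : measurableType dO')
    (P' : probability Omega' R) (Z : nat -> {RV P' >-> nat})
    (A : set ((r - 2).-tuple nat)) :
  (1 <= n)%N -> (3 <= r)%N -> (3 <= d)%N -> (8 * r + 4 * d <= n)%N ->
  (0 < #|regular_graphs n d|)%N ->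
  uniform_regular_graph d G ->
  mutually_independent [set k : nat | (3 <= k)%N] Z ->
  (forall k : nat, (3 <= k)%N ->
     poisson_distributed (Z k) ((d%:R - 1) ^+ k / (2 * k%:R))) ->
  measurable [set w | A [tuple Z (i + 3)%N w | i < r - 2]] ->
  (P [set w | A [tuple cycle_count (i + 3) (G w) | i < r - 2]] <=
   P' [set w | A [tuple Z (i + 3)%N w | i < r - 2]] +
   (1000 * Num.sqrt r%:R * (d%:R - 1) `^ (3 * r%:R / 2 - 1) / n%:R)%:E)%E.
Proof.
move=> n0 r3 d3 nbig S0 unif indep Zpois mA.
pose vec (w : nat -> nat) := [tuple w (i + 3)%N | i < r - 2].
pose counts (h : sgraph n) := fun k => cycle_count k h.
pose m := (\sum_(h : sgraph n) \sum_(k < r.+1) cycle_count k h).+1.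
have counts_lt h k : (k <= r)%N -> (counts h k < m)%N.
  rewrite -ltnS => kr; rewrite ltnS (bigD1 h) //= (bigD1 (Ordinal kr)) //=.
  by rewrite -addnA leq_addr.
pose f (w : nat -> nat) : R :=
  `[< A (vec w) /\ forall k, (3 <= k <= r)%N -> (w k < m)%N >]%:R.
have f01 w : 0 <= f w <= 1 by rewrite /f ler0n lern1 leq_b1.
have f_out w k : (3 <= k <= r)%N -> (m <= w k)%N -> f w = 0.
  move=> k3r; rewrite leqNgt => /negP wk; rewrite /f asboolF //.
  by case=> _ /(_ k k3r).
have f_ext w w' : (forall k, (3 <= k <= r)%N -> w k = w' k) -> f w = f w'.
  move=> eqw; rewrite /f; congr (_ %:R); congr nat_of_bool; apply/asbool_equiv_eq.
  have -> : vec w = vec w'.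
    apply: eq_from_tnth => i; rewrite !tnth_mktuple; apply: eqw.
    by have := ltn_ord i; clear; lia.
  by split=> -[Av wm]; split=> // k k3r; move: (wm k k3r); rewrite eqw.
pose p k := poisson_pmf (rate R d k).
pose s k : R := Num.sqrt (rate R d k).
have law k : poisson_law (s k.+3) (p k.+3) by apply: poisson_pmf_law; apply: rate_ge1.
have qE : d.-1%:R = d%:R - 1 :> R.
  by rewrite -[in RHS](ltn_predK d3) -natr1 addrK.
have s_sqr k : s k.+3 ^+ 2 = d.-1%:R ^+ k.+3 / (2 * k.+3%:R).
  by rewrite sqr_sqrtr ?qE // (le_trans ler01) // rate_ge1.
have := counts_error law f01 f_out f_ext d3 nbig s_sqr (fun=> 0%N).
set S := regular_graphs n d in S0 *; set a := average _ _ _ _ _.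
set err := _ / n%:R => le_sum.
have -> : [set w | A [tuple cycle_count (i + 3) (G w) | i < r - 2]] =
    [set w | `[< A (vec (counts (G w))) >]].
  by apply/seteqP; split=> w /= /asboolP.
have [_ ->] := uniform_event (fun h => `[< A (vec (counts h)) >]) unif.
have SR : 0 < #|S|%:R :> R by rewrite ltr0n.
have le_a : (a%:E <= P' [set w | A [tuple Z (i + 3)%N w | i < r - 2]])%E.
  rewrite /a; apply: (average_le_prob _ indep _ r3 _ f_ext _ mA) => [k j k3|w|w].
  - exact: Zpois.
  - by rewrite /f; case: asboolP => _; [right | left].
  rewrite /f; case: asboolP => [[]//|_] /eqP.
  by rewrite eq_sym oner_eq0.
have fE h : f (counts h) = (`[< A (vec (counts h)) >])%:R.
  rewrite /f; congr (_ %:R); congr nat_of_bool; apply/asbool_equiv_eq.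
  by split=> [[]//|Ah]; split=> // k /andP[_ kr]; apply: counts_lt.
apply: (@le_trans _ _ (a + err)%:E); last by rewrite EFinD leeD2r.
rewrite lee_fin mulrC ler_pdivrMr // mulrDl -lerBlDl.
have -> : \sum_(h in S) (`[< A (vec (counts h)) >])%:R - a * #|S|%:R =
    \sum_(h in S) (f (counts h) - a).
  by rewrite sumrB sumr_const mulr_natr; congr (_ - _); apply: eq_bigr => h _; rewrite fE.
apply: le_trans (ler_norm _) _; apply: le_trans le_sum _.
rewrite [leRHS]mulrC; apply: le_trans (ler_wpM2l (ltW SR) (error_sum R n0 r3 d3)).
rewrite big_distrr /= le_eqVlt; apply/orP; left; apply/eqP.
apply: eq_bigr => i _; rewrite qE -/(s i.+3).
by rewrite (mulrC 138) -!mulrA.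
Qed.

Lemma probability_real (dO : measure_display) (Omega : measurableType dO)
    (R : realType) (P : probability Omega R) (A : set Omega) : measurable A ->
  exists2 x : R, 0 <= x <= 1 & P A = x%:E.
Proof.
move=> mA; have finA : P A \is a fin_num by apply: fin_num_measure.
exists (fine (P A)); last by rewrite fineK.
rewrite fine_ge0 //= -lee_fin fineK //; exact: probability_le1.
Qed.

Theorem theorem2p5 (R : realType) :
  exists c : R, forall (n r d : nat),
    (1 <= n)%N -> (3 <= r)%N -> (3 <= d)%N ->
    (0 < #|regular_graphs n d|)%N ->
  forall (dO : measure_display) (Omega : measurableType dO)
    (P : probability Omega R) (G : {RV P >-> sgraph n})
    (dO' : measure_display) (Omega' : measurableType dO')
    (P' : probability Omega' R) (Z : nat -> {RV P' >-> nat}),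
    uniform_regular_graph d G ->
    mutually_independent [set k : nat | (3 <= k)%N] Z ->
    (forall k : nat, (3 <= k)%N ->
      poisson_distributed (Z k) ((d%:R - 1) ^+ k / (2 * k%:R))) ->
    (dTV
       (pushforward P
         (fun w => [tuple cycle_count (i + 3) (G w) | i < r - 2]))
       (pushforward P' (fun w => [tuple Z (i + 3)%N w | i < r - 2]))
     <= (c * Num.sqrt r%:R * (d%:R - 1) `^ (3 * r%:R / 2 - 1) / n%:R)%:E)%E.
Proof.
exists 1000 => n r d n0 r3 d3 S0 dO Omega P G dO' Omega' P' Z unif indep Zpois.
apply: ge_ereal_sup => _ [A mA <-]; rewrite /pushforward.
set B := _ @^-1` A; set B' := _ @^-1` A; set err := _ / n%:R.
have mB (A' : set ((r - 2).-tuple nat)) :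
    measurable [set w | A' [tuple cycle_count (i + 3) (G w) | i < r - 2]].
  have [] := uniform_event
    (fun h => `[< A' [tuple cycle_count (i + 3) h | i < r - 2] >]) unif.
  rewrite (_ : [set w | _] = [set w | A' [tuple cycle_count (i + 3) (G w) | i < r - 2]]) //.
  by apply/seteqP; split=> w /= /asboolP.
have mB' (A' : set ((r - 2).-tuple nat)) : measurable A' ->
    measurable [set w | A' [tuple Z (i + 3)%N w | i < r - 2]].
  move=> mA'; rewrite -[X in measurable X]setTI.
  apply: (_ : measurable_fun setT (fun w => [tuple Z (i + 3)%N w | i < r - 2])) => //.
  apply/measurable_fun_tnthP => i.
  rewrite (_ : _ \o _ = Z (i + 3)%N); first exact: measurable_funP.
  by apply/funext => w /=; rewrite tnth_mktuple.
have [x /andP[x0 x1] PB] := probability_real P (mB A).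
have [y /andP[y0 y1] PB'] := probability_real P' (mB' A mA).
rewrite [P B]PB [P' B']PB' -EFinB /= lee_fin ler_distl.
have [big|small] := leqP (8 * r + 4 * d) n; last first.
  have err1 : 1 <= err := error_trivial R n0 r3 d3 small.
  by apply/andP; split; lra.
have le_mA (A' : set ((r - 2).-tuple nat)) (mA' : measurable A') :=
  cycle_counts_poisson_le n0 r3 d3 big S0 unif indep Zpois (mB' A' mA').
apply/andP; split; last by have := le_mA A mA; rewrite PB PB' -EFinD lee_fin.
have := le_mA (~` A) (measurableC mA).
rewrite [X in (P X <= _)%E](_ : _ = ~` B) // [X in (_ <= P' X + _)%E](_ : _ = ~` B') //.
rewrite !probability_setC; [|exact: (mB' A)|exact: (mB A)].
rewrite PB PB' -!EFinB -EFinD lee_fin -/err; lra.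
Qed.
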